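(* Let $h:\mathbb{R}\to\mathbb{R}$ satisfy: (1) $h$ is even; (2) $h\in C^2$ and $h(0)=h'(0)=h''(0)=0$; (3) $h''$ is strictly increasing, unbounded and concave on $[0,\infty)$; and moreover $$\sum_n\frac{1}{h\big(\sqrt{n/\ln\ln n}\big)}<\infty .$$ Consider the game UFQSH with this parameter $h$, in which Forecaster's moves are constant: $m_n\equiv m\in\mathbb{R}$, $v_n\equiv v\ge 0$, $w_n\equiv w\ge 0$. Write $S_n=\sum_{i=1}^n x_i$. Then for $m'\in\mathbb{R}$ and $v'\ge 0$ the following are equivalent: 1. $m'=m$ and $v'=v$. 2. Skeptic can force $$\limsup_{n\to\infty}\frac{S_n-m'n}{\sqrt{2n\ln\ln n}}=\sqrt{v'}.$$ 3. Reality can comply with the event $$\limsup_{n\to\infty}\frac{S_n-m'n}{\sqrt{2n\ln\ln n}}=\sqrt{v'}.$$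
   Context: UFQSH (Unbounded Forecasting Game with Quadratic and Stronger Hedges) with parameter $h:\mathbb{R}\to\mathbb{R}$ is the following perfect-information game between Forecaster, Skeptic and Reality. Put $\mathcal{K}_0:=1$. In each round $n=1,2,\ldots$: Forecaster announces $m_n\in\mathbb{R}$, $v_n\ge 0$, $w_n\ge 0$; then Skeptic announces $M_n,V_n,W_n\in\mathbb{R}$; then Reality announces $x_n\in\mathbb{R}$; and Skeptic's capital is updated by $$\mathcal{K}_n:=\mathcal{K}_{n-1}+M_n(x_n-m_n)+V_n\big((x_n-m_n)^2-v_n\big)+W_n\big(h(x_n-m_n)-w_n\big).$$ Collateral duties: Skeptic must keep $\mathcal{K}_n$ non-negative; Reality must keep $\mathcal{K}_n$ from tending to infinity; Forecaster must keep the game coherent. The game is coherent if Reality can make the capital not increase at any round, i.e. for every $n$ and every $(M,V,W)\in\mathbb{R}^3$ there is $x\in\mathbb{R}$ with $M(x-m_n)+V((x-m_n)^2-v_n)+W(h(x-m_n)-w_n)\le 0$. In particular the constants $m,v,w$ are such that the game is coherent. An event is a property of the infinite sequence of moves of Forecaster and Reality. A strategy for a player chooses that player's move as a function of all moves made before it. Skeptic can force an event $E$ if he has a strategy such that, whatever Reality does and whatever Forecaster does subject to his collateral duty, $\mathcal{K}_n\ge 0$ for all $n$, and either $E$ happens or $\mathcal{K}_n\to\infty$. By a strategy $\mathcal{R}$, Reality complies with the event $E$ if (i) irrespective of the moves of Forecaster and Skeptic, both observing their collateral duties, $E$ happens, and (ii) $\sup_n\mathcal{K}_n<\infty$; Reality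 can comply with $E$ if she has such a strategy. Convention: sums and expressions involving $\ln\ln n$ are taken over $n\ge 3$. *)

(* Defs.v *)
From Stdlib Require Import Reals List.
From Coquelicot Require Import Coquelicot.
Import ListNotations.
Open Scope R_scope.

Record forecast := Forecast { fc_m : R; fc_v : R; fc_w : R }.
Record stake := Stake { st_M : R; st_V : R; st_W : R }.
Record round := Round { rd_fc : forecast; rd_st : stake; rd_x : R }.

(** Rounds are numbered from 0: [p i] is the round that the usual notation
    indexes by [i + 1], while [capital h p n] is the capital after [n] rounds. *)
Definition play := nat -> round.

Definition gain (h : R -> R) (f : forecast) (s : stake) (x : R) : R :=
  st_M s * (x - fc_m f)
  + st_V s * ((x - fc_m f) ^ 2 - fc_v f)
  + st_W s * (h (x - fc_m f) - fc_w f).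

Fixpoint capital (h : R -> R) (p : play) (n : nat) : R :=
  match n with
  | O => 1
  | S k => capital h p k + gain h (rd_fc (p k)) (rd_st (p k)) (rd_x (p k))
  end.

Definition forecasts (p : play) (n : nat) : forecast := rd_fc (p n).
Definition outcomes (p : play) (n : nat) : R := rd_x (p n).

(** The complete rounds preceding round [n]. *)
Definition history (p : play) (n : nat) : list round := map p (seq 0 n).

Definition skeptic_strategy := list round -> forecast -> stake.
Definition reality_strategy := list round -> forecast -> stake -> R.

Definition skeptic_follows (sigma : skeptic_strategy) (p : play) : Prop :=
  forall n, rd_st (p n) = sigma (history p n) (rd_fc (p n)).
Definition reality_follows (rho : reality_strategy) (p : play) : Prop :=
  forall n, rd_x (p n) = rho (history p n) (rd_fc (p n)) (rd_st (p n)).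

Definition coherent (h : R -> R) (f : forecast) : Prop :=
  forall s : stake, exists x : R, gain h f s x <= 0.

Definition forecaster_duty (h : R -> R) (p : play) : Prop :=
  forall n, 0 <= fc_v (rd_fc (p n)) /\ 0 <= fc_w (rd_fc (p n))
            /\ coherent h (rd_fc (p n)).
Definition skeptic_duty (h : R -> R) (p : play) : Prop :=
  forall n, 0 <= capital h p n.

Definition event := (nat -> forecast) -> (nat -> R) -> Prop.

(** [F] restricts the move sequences available to Forecaster, so that variants
    of the game (unrestricted, or with constant forecasts) share the following
    two definitions. *)
Definition skeptic_can_force (h : R -> R) (F : (nat -> forecast) -> Prop)
    (E : event) : Prop :=
  exists sigma : skeptic_strategy, forall p : play,
    skeptic_follows sigma p -> F (forecasts p) -> forecaster_duty h p ->
    (forall n, 0 <= capital h p n)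
    /\ (E (forecasts p) (outcomes p) \/ is_lim_seq (capital h p) p_infty).

Definition reality_can_comply (h : R -> R) (F : (nat -> forecast) -> Prop)
    (E : event) : Prop :=
  exists rho : reality_strategy, forall p : play,
    reality_follows rho p -> F (forecasts p) -> forecaster_duty h p ->
    skeptic_duty h p ->
    E (forecasts p) (outcomes p)
    /\ exists B : R, forall n, capital h p n <= B.

Definition constant_forecasts (m v w : R) (f : nat -> forecast) : Prop :=
  forall n, f n = Forecast m v w.

(** [partial_sum x n] has [n] terms, unlike [sum_f_R0 x n] and [sum_n x n]. *)
Fixpoint partial_sum (x : nat -> R) (n : nat) : R :=
  match n with
  | O => 0
  | S k => partial_sum x k + x k
  end.

(** The limit superior is an extended real and is here required to be finite;
    the terms with [n < 3], where [ln (ln n)] is not meaningful or not positive,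
    do not affect it. *)
Definition LIL_event (m' v' : R) : event := fun _ x =>
  is_LimSup_seq
    (fun n => (partial_sum x n - m' * INR n)
              / sqrt (2 * INR n * ln (ln (INR n))))
    (Finite (sqrt v')).

Definition even_function (h : R -> R) : Prop := forall x, h (- x) = h x.

Definition C2 (h : R -> R) : Prop :=
  (forall x, ex_derive h x)
  /\ (forall x, ex_derive_n h 2 x)
  /\ (forall x, continuous (Derive_n h 2) x).

Definition strictly_increasing_nonneg (f : R -> R) : Prop :=
  forall x y, 0 <= x -> x < y -> f x < f y.

Definition unbounded_nonneg (f : R -> R) : Prop :=
  forall B, exists x, 0 <= x /\ B < Rabs (f x).

Definition concave_nonneg (f : R -> R) : Prop :=
  forall x y t, 0 <= x -> 0 <= y -> 0 <= t <= 1 ->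
    t * f x + (1 - t) * f y <= f (t * x + (1 - t) * y).

(* Main.v *)
Require Import Defs.
From Stdlib Require Import Reals.
From Coquelicot Require Import Coquelicot.
From Stdlib Require Import Arith Lra Lia List.
From Stdlib Require Import Classical ClassicalEpsilon IndefiniteDescription.
Import ListNotations.
Open Scope R_scope.

(** Everything follows from one fact: Skeptic can force the law of the iterated
    logarithm with the announced [m] and [v] ([force_LIL]).

    Given this, Reality complies with that law by imagining a second Skeptic who
    forces it: coherence lets her choose each outcome so that the sum of the
    capitals of the real and the imagined Skeptic does not increase; both stay
    bounded, so the forced event happens ([comply_of_force]). If Skeptic forces,
    or Reality complies with, the law for other values [m'] and [v'], a play
    between this strategy and one of the former kind satisfies both laws
    ([force_comply_meet]), and the two laws together give [m' = m] and [v' = v]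
    ([LIL_event_unique]).

    To force the law, write [y i] for the centred outcomes. An event is called
    [null] when a nonnegative capital becomes unbounded on it. Null events are
    closed under countable unions, a Borel-Cantelli lemma holds ([null_limsup]),
    and a null event can be avoided in the sense of the game ([force_of_null]).
    For [v = 0] the squares of the increments come for free and Cauchy-Schwarz
    suffices. For [v > 0] three kinds of events have to be null.

    - Infinitely many increments exceed [d * sqrt (n / ln (ln n))]: the hedge [h]
      provides insurance against the [n]-th one at a price proportional to
      [/ h (d * sqrt (n / ln (ln n)))], and these prices are summable
      ([null_not_moderate]). In the other two cases the increments may thus be
      taken to be small compared with the inverse of the betting rate.
    - The sums exceed [(1 + e) * sqrt v] times the scale infinitely often: bets
      on [lam * y] and on its square have a capital close to
      [exp (lam * S - lam ^ 2 * v * n / 2)]; with [lam] adapted to the times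
      [exp (c * k)] this is the classical proof of the upper half ([null_upper]).
    - The sums stay below [(1 - e) * sqrt v] times the scale: in each block of a
      geometric sequence of times Skeptic goes short of an exponential process of
      rate [lam] and covers the event of a moderate final sum by a long position
      of smaller rate ([block_capital]). The position is closed when the short
      process reaches a level; because the line on which this happens is tangent
      to the parabola [sqrt n], it happens only if the sums are large. A large
      increment would ruin a short position that is quadratic in it; here the
      hedge [h], which grows faster than a square, is bought as a protection, and
      the convergence of the series makes its total cost per block bounded.
      A block that ends at time [n] then yields a relative gain of the order of
      [/ ln n ^ p] with [p < 1]; since [ln n] is linear in the number of the
      block, these gains have an infinite sum, and the capital, which is
      reinvested from block to block, is unbounded ([null_lower]). *)

(** * Finite sums *)

Lemma partial_sum_ge0 a n : (forall k, 0 <= a k) -> 0 <= partial_sum a n.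
Proof.
  intros Ha; induction n as [|n IH]; simpl; [lra|].
  specialize (Ha n); lra.
Qed.

Lemma partial_sum_le a b n :
  (forall k, (k < n)%nat -> a k <= b k) -> partial_sum a n <= partial_sum b n.
Proof.
  induction n as [|n IH]; intros H; simpl; [lra|].
  assert (a n <= b n) by (apply H; lia).
  assert (partial_sum a n <= partial_sum b n) by (apply IH; intros; apply H; lia).
  lra.
Qed.

Lemma partial_sum_ext a b n :
  (forall k, (k < n)%nat -> a k = b k) -> partial_sum a n = partial_sum b n.
Proof.
  intros H; apply Rle_antisym; apply partial_sum_le; intros k Hk; rewrite (H k Hk); lra.
Qed.

Lemma partial_sum_incr a n p :
  (forall k, 0 <= a k) -> (n <= p)%nat -> partial_sum a n <= partial_sum a p.
Proof.
  intros Ha H; induction H as [|p H IH]; simpl; [lra|].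
  specialize (Ha p); lra.
Qed.

Lemma partial_sum_scal c a n :
  partial_sum (fun k => c * a k) n = c * partial_sum a n.
Proof. induction n as [|n IH]; simpl; [ring|rewrite IH; ring]. Qed.

Lemma partial_sum_minus a b n :
  partial_sum (fun k => a k - b k) n = partial_sum a n - partial_sum b n.
Proof. induction n as [|n IH]; simpl; [ring|rewrite IH; ring]. Qed.

Lemma partial_sum_shift a p n :
  partial_sum a (p + n) = partial_sum a p + partial_sum (fun k => a (p + k)%nat) n.
Proof.
  induction n as [|n IH].
  - rewrite Nat.add_0_r; simpl; ring.
  - rewrite Nat.add_succ_r; simpl; rewrite IH; ring.
Qed.

Lemma partial_sum_term_le a n k :
  (forall k, 0 <= a k) -> (k < n)%nat -> a k <= partial_sum a n.
Proof.
  intros Ha Hk.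
  assert (H := partial_sum_incr a (S k) n Ha Hk); simpl in H.
  assert (H' := partial_sum_ge0 a k Ha); lra.
Qed.

Lemma partial_sum_half n : partial_sum (fun k => (/ 2) ^ S k) n = 1 - (/ 2) ^ n.
Proof. induction n as [|n IH]; simpl in *; [ring|]. rewrite IH; field. Qed.

(** * Capital processes and null events *)

(** Histories are lists with the latest outcome first, so that processes can be
    defined by recursion on the history. *)
Fixpoint past (y : nat -> R) (n : nat) : list R :=
  match n with
  | O => []
  | S k => y k :: past y k
  end.

Lemma length_past y n : length (past y n) = n.
Proof. induction n; simpl; auto. Qed.

Fixpoint frozen (P : list R -> Prop) (l : list R) : Prop :=
  match l with
  | [] => P []
  | y :: l' => frozen P l' \/ P (y :: l')
  end.

Fixpoint stopped (P : list R -> Prop) (K : list R -> R) (l : list R) : R :=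
  match l with
  | [] => K []
  | y :: l' => if excluded_middle_informative (frozen P l') then stopped P K l'
               else K (y :: l')
  end.

Lemma frozen_here (P : list R -> Prop) l : P l -> frozen P l.
Proof. destruct l; simpl; auto. Qed.

Lemma stopped_unfrozen P K l : ~ frozen P l -> stopped P K l = K l.
Proof.
  destruct l as [|y l]; simpl; auto; intros H.
  destruct (excluded_middle_informative (frozen P l)); tauto.
Qed.

Lemma stopped_cons_frozen P K y l :
  frozen P l -> stopped P K (y :: l) = stopped P K l.
Proof. simpl; intros H; destruct (excluded_middle_informative (frozen P l)); tauto. Qed.

Lemma stopped_cons_unfrozen P K y l :
  ~ frozen P l -> stopped P K (y :: l) = K (y :: l).
Proof. simpl; intros H; destruct (excluded_middle_informative (frozen P l)); tauto. Qed.

Lemma stopped_idle P K N :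
  (forall l, (length l <= N)%nat -> K l = 1) ->
  forall l, (length l <= N)%nat -> stopped P K l = 1.
Proof.
  intros HK; induction l as [|y l IH]; intros Hl; simpl; [apply HK; auto|].
  destruct (excluded_middle_informative (frozen P l)); [|apply HK; auto].
  apply IH; simpl in Hl; lia.
Qed.

Lemma frozen_past P y n p :
  (n <= p)%nat -> frozen P (past y n) -> frozen P (past y p).
Proof. intros H; induction H; simpl; auto. Qed.

Section Processes.

Variables (h : R -> R) (v w : R).

(** The outcomes are centred, hence the forecast [0] of the mean. Only an upper
    bound on the increments is asked for: Skeptic may end up with more. *)
Definition hedgeable (d : R -> R) : Prop :=
  exists s, forall y, d y <= gain h (Forecast 0 v w) s y.

Lemma hedgeable_le d e : (forall y, d y <= e y) -> hedgeable e -> hedgeable d.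
Proof.
  intros H [s Hs]; exists s; intros y.
  apply Rle_trans with (1 := H y), Hs.
Qed.

Lemma hedgeable_0 : hedgeable (fun _ => 0).
Proof. exists (Stake 0 0 0); intros y; unfold gain; simpl; lra. Qed.

Lemma hedgeable_plus d e :
  hedgeable d -> hedgeable e -> hedgeable (fun y => d y + e y).
Proof.
  intros [s Hs] [t Ht].
  exists (Stake (st_M s + st_M t) (st_V s + st_V t) (st_W s + st_W t)); intros y.
  specialize (Hs y); specialize (Ht y); unfold gain in *; simpl in *; lra.
Qed.

Lemma hedgeable_scal c d :
  0 <= c -> hedgeable d -> hedgeable (fun y => c * d y).
Proof.
  intros Hc [s Hs].
  exists (Stake (c * st_M s) (c * st_V s) (c * st_W s)); intros y.
  apply Rle_trans with (c * gain h (Forecast 0 v w) s y).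
  - apply Rmult_le_compat_l; auto.
  - unfold gain; simpl; lra.
Qed.

Lemma hedgeable_sum (d : nat -> R -> R) n :
  (forall k, (k < n)%nat -> hedgeable (d k)) ->
  hedgeable (fun y => partial_sum (fun k => d k y) n).
Proof.
  induction n as [|n IH]; intros H; simpl; [apply hedgeable_0|].
  apply hedgeable_plus; [apply IH; intros; apply H; lia|apply H; lia].
Qed.

Definition supermartingale (K : list R -> R) : Prop :=
  forall l, hedgeable (fun y => K (y :: l) - K l).

Definition capital_process (N : nat) (K : list R -> R) : Prop :=
  supermartingale K /\ (forall l, 0 <= K l)
  /\ (forall l, (length l <= N)%nat -> K l = 1).

Lemma capital_process_le M N K :
  (M <= N)%nat -> capital_process N K -> capital_process M K.
Proof.
  intros H (H1 & H2 & H3); repeat split; auto.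
  intros l Hl; apply H3; lia.
Qed.

(** Skeptic may be required to wait until any given round [N]: this is what allows
    to combine countably many processes, see [mix]. *)
Definition null (A : (nat -> R) -> Prop) : Prop :=
  forall N, exists K, capital_process N K
    /\ forall y, A y -> forall C, exists n, C <= K (past y n).

Lemma null_incl (A B : (nat -> R) -> Prop) :
  (forall y, A y -> B y) -> null B -> null A.
Proof.
  intros H HB N; destruct (HB N) as (K & HK & HC).
  exists K; split; auto.
Qed.

(** The account [k] is opened in round [k] only, so that in each round the
    stakes of finitely many accounts are added. *)
Definition mix (a : nat -> R) (K : nat -> list R -> R) (l : list R) : R :=
  1 + partial_sum (fun k => a k * (K k l - 1)) (length l).

Lemma mix_extend a K l n :
  (forall k, capital_process k (K k)) -> (length l <= n)%nat ->
  mix a K l = 1 + partial_sum (fun k => a k * (K k l - 1)) n.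
Proof.
  intros HK H; unfold mix; induction H as [|n H IH]; simpl; [reflexivity|].
  rewrite IH; destruct (HK n) as (_ & _ & E); rewrite (E l H); ring.
Qed.

Lemma mix_ge a K l n :
  (forall k, capital_process k (K k)) -> (forall k, 0 <= a k) ->
  (forall n, partial_sum a n <= 1) ->
  partial_sum (fun k => a k * K k l) n <= mix a K l.
Proof.
  intros HK Ha Hs.
  set (p := Nat.max n (length l)).
  rewrite (mix_extend a K l p HK) by (unfold p; lia).
  apply Rle_trans with (partial_sum (fun k => a k * K k l) p).
  - apply partial_sum_incr; [|unfold p; lia].
    intros k; apply Rmult_le_pos; [auto|apply (HK k)].
  - rewrite (partial_sum_ext (fun k => a k * (K k l - 1))
               (fun k => a k * K k l - a k)) by (intros; ring).
    rewrite partial_sum_minus; specialize (Hs p); lra.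
Qed.

Lemma mix_capital_process N a K :
  (forall k, capital_process (N + k) (K k)) -> (forall k, 0 <= a k) ->
  (forall n, partial_sum a n <= 1) -> capital_process N (mix a K).
Proof.
  intros HK Ha Hs.
  assert (HK' : forall k, capital_process k (K k))
    by (intros k; apply capital_process_le with (2 := HK k); lia).
  split; [|split].
  - intros l.
    apply hedgeable_le with
      (fun y => partial_sum (fun k => a k * (K k (y :: l) - K k l)) (S (length l))).
    + intros y.
      rewrite (mix_extend a K l (S (length l))) by (auto; lia).
      rewrite (mix_extend a K (y :: l) (S (length l))) by (auto; simpl; lia).
      rewrite (partial_sum_ext (fun k => a k * (K k (y :: l) - K k l))
        (fun k => a k * (K k (y :: l) - 1) - a k * (K k l - 1)))
        by (intros; ring).
      rewrite partial_sum_minus; lra.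
    + apply (hedgeable_sum (fun k y => a k * (K k (y :: l) - K k l))).
      intros k _; apply hedgeable_scal; [auto|apply (HK k)].
  - intros l; apply Rle_trans with (2 := mix_ge a K l 0 HK' Ha Hs); simpl; lra.
  - intros l Hl; unfold mix.
    rewrite (partial_sum_ext _ (fun _ => 0 * 0)).
    + rewrite partial_sum_scal; ring.
    + intros k _; destruct (HK k) as (_ & _ & E); rewrite E by lia; ring.
Qed.

Lemma stopped_supermartingale P K :
  (forall l, ~ frozen P l -> hedgeable (fun y => K (y :: l) - K l)) ->
  supermartingale (stopped P K).
Proof.
  intros HK l; destruct (classic (frozen P l)) as [H|H].
  - apply hedgeable_le with (2 := hedgeable_0); intros y.
    rewrite stopped_cons_frozen by auto; lra.
  - apply hedgeable_le with (2 := HK l H); intros y.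
    rewrite stopped_cons_unfrozen, stopped_unfrozen by auto; lra.
Qed.

(** A process stopped on reaching a level stays above it afterwards: this turns
    an unbounded capital into one that tends to infinity. *)
Lemma capital_process_stopped_level N K L :
  capital_process N K -> exists K', capital_process N K' /\
    forall y n p, (n <= p)%nat -> L <= K (past y n) -> L <= K' (past y p).
Proof.
  intros (H1 & H2 & H3).
  set (P := fun l => L <= K l).
  exists (stopped P K); split; [split; [|split]|].
  - apply stopped_supermartingale; auto.
  - induction l as [|y l IH]; simpl; auto.
    destruct (excluded_middle_informative (frozen P l)); auto.
  - apply stopped_idle; auto.
  - intros y n p Hnp Hn.
    assert (Hf : frozen P (past y p))
      by (apply frozen_past with n; auto; apply frozen_here; exact Hn).
    revert Hf; generalize (past y p); clear -P.
    induction l as [|z l IH]; simpl; auto; intros Hf.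
    destruct (excluded_middle_informative (frozen P l)); [auto|].
    destruct Hf; tauto.
Qed.

(** Borel and Cantelli: the accounts [K k] are mixed with the summable weights
    [a k]; each one that multiplies its share [a k] up to [1] adds the same
    amount to the mixture. *)
Lemma borel_cantelli (K : nat -> list R -> R) (a : nat -> R) (B : R) (k0 : nat) :
  (forall k, (k0 <= k)%nat -> capital_process k (K k)) ->
  (forall k, 0 <= a k) -> (forall n, partial_sum a n <= B) ->
  forall N, exists K', capital_process N K' /\
    forall y, (forall p, exists k n, (p <= k)%nat /\ 1 <= a k * K k (past y n)) ->
    is_lim_seq (fun n => K' (past y n)) p_infty.
Proof.
  intros HK Ha HB N.
  set (N' := Nat.max N k0).
  assert (B0 : 0 <= B) by exact (HB 0%nat).
  assert (HL : forall k, exists K', capital_process (N + k) K' /\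
    forall y n p, (n <= p)%nat -> 1 <= a (N' + k)%nat * K (N' + k)%nat (past y n) ->
      1 <= a (N' + k)%nat * K' (past y p)).
  { intros k.
    destruct (capital_process_stopped_level (N + k) (K (N' + k)%nat)
                (/ a (N' + k)%nat)) as (K' & H1 & H2).
    { apply capital_process_le with (N' + k)%nat; [unfold N'; lia|].
      apply HK; unfold N'; lia. }
    exists K'; split; auto; intros y n p Hnp H.
    assert (Hpos : 0 < a (N' + k)%nat).
    { destruct (Rle_lt_or_eq_dec _ _ (Ha (N' + k)%nat)) as [?|E]; auto.
      rewrite <- E in H; lra. }
    apply Rmult_le_reg_l with (/ a (N' + k)%nat); [apply Rinv_0_lt_compat; auto|].
    rewrite <- Rmult_assoc, Rinv_l, Rmult_1_l, Rmult_1_r by lra.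
    apply (H2 y n p Hnp).
    apply Rmult_le_reg_l with (a (N' + k)%nat); auto.
    rewrite Rinv_r by lra; exact H. }
  apply functional_choice in HL; destruct HL as [K' HK'].
  set (b := fun k => / (B + 1) * a (N' + k)%nat).
  assert (Hb0 : forall k, 0 <= b k).
  { intros k; apply Rmult_le_pos; auto; left; apply Rinv_0_lt_compat; lra. }
  assert (Hb1 : forall n, partial_sum b n <= 1).
  { intros n; unfold b; rewrite partial_sum_scal.
    apply Rmult_le_reg_l with (B + 1); [lra|].
    rewrite <- Rmult_assoc, Rinv_r, Rmult_1_l by lra.
    assert (Hsh := partial_sum_shift a N' n).
    specialize (HB (N' + n)%nat); assert (H := partial_sum_ge0 a N' Ha); lra. }
  exists (mix b K'); split; [apply mix_capital_process; auto; apply HK'|].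
  intros y Hy.
  assert (Hcount : forall c : nat, exists m n0, forall n, (n0 <= n)%nat ->
    / (B + 1) * INR c <= partial_sum (fun k => b k * K' k (past y n)) m).
  { induction c as [|c (m & n0 & IH)].
    - exists 0%nat, 0%nat; intros n _; simpl; lra.
    - destruct (Hy (N' + m)%nat) as (k & n1 & Hk & H1).
      exists (S (k - N')), (Nat.max n0 n1); intros n Hn.
      rewrite S_INR.
      assert (H2 := IH n ltac:(lia)).
      assert (H3 : partial_sum (fun k => b k * K' k (past y n)) m
                 <= partial_sum (fun k => b k * K' k (past y n)) (k - N')).
      { apply partial_sum_incr; [|lia].
        intros j; apply Rmult_le_pos; auto; apply (HK' j). }
      assert (H4 : / (B + 1) * 1 <= b (k - N')%nat * K' (k - N')%nat (past y n)).
      { unfold b; rewrite Rmult_assoc.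
        apply Rmult_le_compat_l; [left; apply Rinv_0_lt_compat; lra|].
        apply (proj2 (HK' (k - N')%nat)) with n1; [lia|].
        replace (N' + (k - N'))%nat with k by lia; exact H1. }
      simpl; lra. }
  apply is_lim_seq_spec; intros M.
  destruct (INR_unbounded ((B + 1) * (M + 1))) as [c Hc].
  destruct (Hcount c) as (m & n0 & H).
  exists n0; intros n Hn; specialize (H n Hn).
  assert (H' := mix_ge b K' (past y n) m
    (fun k => capital_process_le k (N + k) (K' k) ltac:(lia) (proj1 (HK' k))) Hb0 Hb1).
  assert (M + 1 < / (B + 1) * INR c).
  { apply Rmult_lt_reg_l with (B + 1); [lra|].
    rewrite <- Rmult_assoc, Rinv_r, Rmult_1_l by lra; lra. }
  lra.
Qed.

Lemma lim_infty_unbounded (u : nat -> R) (C : R) :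
  is_lim_seq u p_infty -> exists n, C <= u n.
Proof.
  intros H; apply is_lim_seq_spec in H; destruct (H C) as [n Hn].
  exists n; left; apply Hn; lia.
Qed.

Lemma null_limsup (K : nat -> list R -> R) (a : nat -> R) (B : R) (k0 : nat) :
  (forall k, (k0 <= k)%nat -> capital_process k (K k)) ->
  (forall k, 0 <= a k) -> (forall n, partial_sum a n <= B) ->
  null (fun y => forall p, exists k n, (p <= k)%nat /\ 1 <= a k * K k (past y n)).
Proof.
  intros HK Ha HB N.
  destruct (borel_cantelli K a B k0 HK Ha HB N) as (K' & H1 & H2).
  exists K'; split; auto; intros y Hy C; apply lim_infty_unbounded; auto.
Qed.

Lemma half_sum_le1 n : partial_sum (fun k => (/ 2) ^ S k) n <= 1.
Proof. rewrite partial_sum_half; assert (0 < (/ 2) ^ n) by (apply pow_lt; lra); lra. Qed.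

Lemma null_union (A : nat -> (nat -> R) -> Prop) :
  (forall j, null (A j)) -> null (fun y => exists j, A j y).
Proof.
  intros HA N.
  assert (H : forall j, exists K, capital_process (N + j) K
    /\ forall y, A j y -> forall C, exists n, C <= K (past y n))
    by (intros j; apply (HA j)).
  apply functional_choice in H; destruct H as [K HK].
  assert (Hpos : forall k, 0 <= (/ 2) ^ S k) by (intros; apply pow_le; lra).
  exists (mix (fun k => (/ 2) ^ S k) K); split.
  - apply mix_capital_process; auto using half_sum_le1; apply HK.
  - intros y [j Hj] C.
    destruct (proj2 (HK j) y Hj (2 ^ S j * C)) as [n Hn].
    exists n.
    assert (HK' : forall k, capital_process k (K k))
      by (intros k; apply capital_process_le with (N + k)%nat; [lia|apply HK]).
    apply Rle_trans with (2 := mix_ge _ K (past y n) (S j) HK' Hpos half_sum_le1).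
    apply Rle_trans with ((/ 2) ^ S j * K j (past y n)).
    + apply Rmult_le_reg_l with (2 ^ S j); [apply pow_lt; lra|].
      rewrite <- Rmult_assoc, <- Rpow_mult_distr, Rinv_r, pow1 by lra; lra.
    + apply (partial_sum_term_le (fun k => (/ 2) ^ S k * K k (past y n))); [|lia].
      intros k; apply Rmult_le_pos; auto; apply (HK k).
Qed.

Lemma null_or (A B : (nat -> R) -> Prop) :
  null A -> null B -> null (fun y => A y \/ B y).
Proof.
  intros HA HB.
  apply null_incl with
    (fun y => exists j, (match j with O => A | S _ => B end) y).
  - intros y [H|H]; [exists 0%nat|exists 1%nat]; exact H.
  - apply (null_union (fun j => match j with O => A | S _ => B end)).
    intros [|j]; auto.
Qed.

Lemma null_tends_to_infinity (A : (nat -> R) -> Prop) :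
  null A -> exists K, capital_process 0 K /\
    forall y, A y -> is_lim_seq (fun n => K (past y n)) p_infty.
Proof.
  intros HA; apply functional_choice in HA; destruct HA as [K HK].
  destruct (borel_cantelli K (fun k => (/ 2) ^ S k) 1 0) with (N := 0%nat)
    as (K' & H1 & H2).
  - intros k _; apply HK.
  - intros; apply pow_le; lra.
  - apply half_sum_le1.
  - exists K'; split; auto; intros y Hy; apply H2; intros p.
    destruct (proj2 (HK p) y Hy (2 ^ S p)) as [n Hn].
    exists p, n; split; auto.
    apply Rle_trans with ((/ 2) ^ S p * 2 ^ S p).
    + rewrite <- Rpow_mult_distr, Rinv_l, pow1 by lra; lra.
    + apply Rmult_le_compat_l; auto; apply pow_le; lra.
Qed.

End Processes.

(** Skeptic's moves are those that hedge the process; his capital is then at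
    least the process. *)
Lemma force_of_null h m v w (bad : (nat -> R) -> Prop) (E : event) :
  null h v w bad ->
  (forall f x, ~ bad (fun i => x i - m) -> E f x) ->
  skeptic_can_force h (constant_forecasts m v w) E.
Proof.
  intros Hn HE.
  destruct (null_tends_to_infinity h v w bad Hn) as (K & (H1 & H2 & H3) & H4).
  apply functional_choice in H1; destruct H1 as [s Hs].
  exists (fun hist _ => s (rev (map (fun r => rd_x r - m) hist))).
  intros p Hf Hc _.
  set (y := fun i => outcomes p i - m).
  assert (Hpast : forall n, rev (map (fun r => rd_x r - m) (history p n)) = past y n).
  { induction n as [|n IH]; [reflexivity|].
    unfold history in *; rewrite seq_S, !map_app, rev_app_distr, IH; reflexivity. }
  assert (Hcap : forall n, K (past y n) <= capital h p n).
  { induction n as [|n IH]; [simpl; rewrite H3 by (simpl; lia); lra|].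
    simpl past; simpl capital.
    rewrite (Hf n), Hpast.
    assert (Ef := Hc n); unfold forecasts in Ef; rewrite Ef.
    specialize (Hs (past y n) (y n)).
    replace (gain h (Forecast m v w) (s (past y n)) (rd_x (p n)))
      with (gain h (Forecast 0 v w) (s (past y n)) (y n)); [lra|].
    unfold gain, y, outcomes; simpl; rewrite Rminus_0_r; reflexivity. }
  split.
  - intros n; apply Rle_trans with (2 := Hcap n), H2.
  - destruct (classic (bad y)) as [Hb|Hb]; [right|left; apply HE, Hb].
    apply is_lim_seq_le_p_loc with (2 := H4 y Hb).
    exists 0%nat; auto.
Qed.

(** * Reinvesting over successive blocks *)

Fixpoint partial_prod (a : nat -> R) (n : nat) : R :=
  match n with
  | O => 1
  | S k => partial_prod a k * a k
  end.

Lemma partial_prod_ge0 a n : (forall k, 0 <= a k) -> 0 <= partial_prod a n.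
Proof.
  intros H; induction n as [|n IH]; simpl; [lra|apply Rmult_le_pos; auto].
Qed.

Lemma partial_prod_1 a n : (forall k, (k < n)%nat -> a k = 1) -> partial_prod a n = 1.
Proof.
  induction n as [|n IH]; intros H; simpl; [reflexivity|].
  rewrite IH, (H n) by (intros; try apply H; lia); ring.
Qed.

Lemma partial_prod_stable a p q :
  (p <= q)%nat -> (forall k, (p <= k)%nat -> a k = 1) ->
  partial_prod a q = partial_prod a p.
Proof.
  intros H Ha; induction H as [|q H IH]; simpl; [reflexivity|].
  rewrite IH, Ha by lia; ring.
Qed.

(** The first [k1] factors cost at most one half each; the others, expanded, give at
    least one plus the sum of the gains. *)
Lemma partial_prod_ge_sum (a t : nat -> R) k1 n :
  (forall k, / 2 <= a k) -> (forall k, 0 <= t k) ->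
  (forall k, (k1 <= k)%nat -> (k < n)%nat -> 1 + t k <= a k) -> (k1 <= n)%nat ->
  (/ 2) ^ k1 * (1 + (partial_sum t n - partial_sum t k1)) <= partial_prod a n.
Proof.
  intros Ha Ht H Hn; induction Hn as [|n Hn IH]; simpl.
  - replace (1 + _) with 1 by ring; rewrite Rmult_1_r.
    clear -Ha; induction k1 as [|k IH]; simpl; [lra|].
    rewrite Rmult_comm; apply Rmult_le_compat; auto; try lra; apply pow_le; lra.
  - assert (Hc : 0 < (/ 2) ^ k1) by (apply pow_lt; lra).
    assert (Hs := partial_sum_incr t k1 n Ht Hn).
    assert (Htn := Ht n).
    apply Rle_trans with ((/ 2) ^ k1 * (1 + (partial_sum t n - partial_sum t k1)) * (1 + t n)).
    + assert (0 <= (partial_sum t n - partial_sum t k1) * t n)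
        by (apply Rmult_le_pos; [lra|auto]).
      rewrite Rmult_assoc; apply Rmult_le_compat_l; lra.
    + apply Rmult_le_compat; try lra.
      * apply Rmult_le_pos; lra.
      * apply IH; intros k H1 H2; apply H; lia.
      * apply H; lia.
Qed.

Section Blocks.

Variables (h : R -> R) (v w : R).

(** In every round at most one factor changes, so that the increment of the product
    is a nonnegative multiple of the increment of that factor. *)
Lemma blocks_capital_process (N : nat) (Z : nat -> list R -> R) (t : nat -> nat) :
  (forall k, (N + k <= t k)%nat) ->
  (forall j k, (j <= k)%nat -> (t j <= t k)%nat) ->
  (forall k, capital_process h v w (t k) (Z k)) ->
  (forall k l y, (t (S k) <= length l)%nat -> Z k (y :: l) = Z k l) ->
  capital_process h v w N (fun l => partial_prod (fun k => Z k l) (length l)).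
Proof.
  intros HN Ht HZ HC; split; [|split].
  - intros l.
    assert (Hact : exists k0, forall k, k <> k0 -> forall y, Z k (y :: l) = Z k l).
    { assert (Hidle : forall k, (length l < t k)%nat -> forall y, Z k (y :: l) = Z k l).
      { intros k Hk y; destruct (HZ k) as (_ & _ & E).
        rewrite !E; simpl; auto; lia. }
      destruct (classic (exists k, (t k <= length l < t (S k))%nat)) as [[k0 Hk0]|Hno].
      - exists k0; intros k Hk y.
        destruct (Nat.lt_ge_cases k k0).
        + apply HC; specialize (Ht (S k) k0 ltac:(lia)); lia.
        + apply Hidle; specialize (Ht (S k0) k ltac:(lia)); lia.
      - exists 0%nat; intros k _ y.
        destruct (Nat.lt_ge_cases (length l) (t k)); [apply Hidle; auto|].
        apply HC; apply Nat.nlt_ge; intros Hlt; apply Hno; exists k; lia. }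
    destruct Hact as [k0 Hk0].
    assert (Hprod : forall n, exists c, 0 <= c /\
      (forall y, partial_prod (fun k => Z k (y :: l)) n - partial_prod (fun k => Z k l) n
        = c * (Z k0 (y :: l) - Z k0 l)) /\ ((n <= k0)%nat -> c = 0)).
    { induction n as [|n (c & Hc & E & Hz)].
      - exists 0; repeat split; auto; try lra; intros; simpl; ring.
      - destruct (Nat.eq_dec n k0) as [->|Hne].
        + exists (partial_prod (fun k => Z k l) k0); repeat split.
          * apply partial_prod_ge0; intros k; apply (HZ k).
          * intros y; simpl; specialize (E y); rewrite Hz in E by lia.
            replace (partial_prod (fun k => Z k (y :: l)) k0)
              with (partial_prod (fun k => Z k l) k0) by lra.
            ring.
          * lia.
        + exists (c * Z n l); repeat split.
          * apply Rmult_le_pos; auto; apply (HZ n).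
          * intros y; simpl; rewrite Hk0 by auto.
            rewrite <- Rmult_minus_distr_r, E; ring.
          * intros H; rewrite Hz by lia; ring. }
    destruct (Hprod (S (length l))) as (c & Hc & E & _).
    apply hedgeable_le with (fun y => c * (Z k0 (y :: l) - Z k0 l)).
    + intros y; rewrite <- E; simpl.
      destruct (HZ (length l)) as (_ & _ & E1).
      rewrite (E1 l), Rmult_1_r by (specialize (HN (length l)); lia); lra.
    + apply hedgeable_scal; auto; apply (HZ k0).
  - intros l; apply partial_prod_ge0; intros k; apply (HZ k).
  - intros l Hl; apply partial_prod_1; intros k _.
    destruct (HZ k) as (_ & _ & E); apply E; specialize (HN k); lia.
Qed.

(** The capital is reinvested from block to block. On [A] all but finitely many
    blocks succeed, and each failure costs at most half of the capital. *)
Lemma null_of_blocks (A : (nat -> R) -> Prop) (Z : nat -> list R -> R)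
    (t : nat -> nat) (th : nat -> R) (k0 : nat) :
  (forall k, (k <= t k)%nat) ->
  (forall j k, (j <= k)%nat -> (t j <= t k)%nat) ->
  (forall k, (k0 <= k)%nat -> capital_process h v w (t k) (Z k)) ->
  (forall k l, (k0 <= k)%nat -> / 2 <= Z k l) ->
  (forall k l y, (k0 <= k)%nat -> (t (S k) <= length l)%nat -> Z k (y :: l) = Z k l) ->
  (forall k, 0 <= th k) ->
  (forall C, exists n, C <= partial_sum th n) ->
  (forall y, A y -> exists k1, forall k n, (k1 <= k)%nat -> (t (S k) <= n)%nat ->
     1 + th k <= Z k (past y n)) ->
  null h v w A.
Proof.
  intros HN Ht HZ HZ2 HC Hth Hdiv HA N.
  set (s := Nat.max N k0).
  exists (fun l => partial_prod (fun k => Z (s + k)%nat l) (length l)); split.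
  - apply blocks_capital_process with (t := fun k => t (s + k)%nat).
    + intros k; specialize (HN (s + k)%nat); unfold s in *; lia.
    + intros j k H; apply Ht; lia.
    + intros k; apply HZ; unfold s; lia.
    + intros k l y H; apply HC; [unfold s; lia|].
      replace (S (s + k)) with (s + S k)%nat by lia; auto.
  - intros y Hy C.
    destruct (HA y Hy) as [k1 Hk1].
    set (th' := fun k => th (s + k)%nat).
    assert (Hsh := partial_sum_shift th s : forall n, partial_sum th (s + n) = partial_sum th s + partial_sum th' n).
    assert (Hp : 0 < 2 ^ k1) by (apply pow_lt; lra).
    destruct (Hdiv (2 ^ k1 * C + partial_sum th' k1 + partial_sum th s)) as [n Hn].
    set (p := Nat.max k1 n).
    (* At the beginning of block [s + p], the blocks before it have ended and
       the others still contribute the factor 1. *)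
    set (q := t (s + p)%nat).
    assert (Hq : (p <= q)%nat) by (unfold q; specialize (HN (s + p)%nat); lia).
    exists q; rewrite length_past.
    set (a := fun k => Z (s + k)%nat (past y q)).
    assert (Hlate : forall k, (p <= k)%nat -> a k = 1).
    { intros k Hk; unfold a.
      destruct (HZ (s + k)%nat ltac:(unfold s; lia)) as (_ & _ & E).
      apply E; rewrite length_past; unfold q; apply Ht; lia. }
    assert (Ha : partial_prod a q = partial_prod a p).
    { apply partial_prod_stable; auto. }
    change (C <= partial_prod a q); rewrite Ha.
    apply Rle_trans with ((/ 2) ^ k1 * (1 + (partial_sum th' p - partial_sum th' k1))).
    + assert (H1 : partial_sum th n <= partial_sum th (s + p))
        by (apply partial_sum_incr; auto; unfold p; lia).
      specialize (Hsh p); rewrite pow_inv.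
      apply Rmult_le_reg_l with (2 ^ k1); auto.
      rewrite <- Rmult_assoc, Rinv_r, Rmult_1_l by lra; lra.
    + apply partial_prod_ge_sum; try (unfold p; lia).
      * intros k; apply HZ2; unfold s; lia.
      * intros k; apply Hth.
      * intros k H H'; apply Hk1; [lia|].
        unfold q; apply Ht; lia.
Qed.
End Blocks.

(** * A comparison lemma *)

Lemma second_order_nonneg (G G1 G2 : R -> R) (x : R) :
  (forall t, Rmin 0 x <= t <= Rmax 0 x -> is_derive G t (G1 t)) ->
  (forall t, Rmin 0 x <= t <= Rmax 0 x -> is_derive G1 t (G2 t)) ->
  (forall t, Rmin 0 x <= t <= Rmax 0 x -> 0 <= G2 t) ->
  G 0 = 0 -> G1 0 = 0 -> 0 <= G x.
Proof.
  intros D1 D2 H2 Z0 Z1.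
  assert (Hmvt : forall F F' z, Rmin 0 x <= z <= Rmax 0 x ->
    (forall t, Rmin 0 x <= t <= Rmax 0 x -> is_derive F t (F' t)) -> F 0 = 0 ->
    exists c, Rmin 0 z <= c <= Rmax 0 z /\ Rmin 0 x <= c <= Rmax 0 x /\ F z = F' c * z).
  { intros F F' z Hz HF F0.
    assert (Hsub : forall t, Rmin 0 z <= t <= Rmax 0 z -> Rmin 0 x <= t <= Rmax 0 x).
    { intros t; revert Hz; unfold Rmin, Rmax; repeat destruct Rle_dec; intros; lra. }
    destruct (MVT_gen F 0 z F') as (c & Hc & E).
    - intros t Ht; apply HF, Hsub; lra.
    - intros t Ht; apply derivable_continuous_pt.
      exists (F' t); apply is_derive_Reals, HF, Hsub, Ht.
    - exists c; repeat split; try apply Hc; try apply Hsub, Hc.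
      rewrite F0 in E; lra. }
  assert (Hx : Rmin 0 x <= x <= Rmax 0 x)
    by (unfold Rmin, Rmax; repeat destruct Rle_dec; lra).
  destruct (Hmvt G G1 x Hx D1 Z0) as (c & Hc & Hc' & ->).
  destruct (Hmvt G1 G2 c Hc' D2 Z1) as (d & _ & Hd & ->).
  specialize (H2 d Hd).
  replace (G2 d * c * x) with (G2 d * (c * x)) by ring.
  apply Rmult_le_pos; auto.
  destruct (Rle_lt_dec 0 x).
  - rewrite Rmin_left in Hc by lra; apply Rmult_le_pos; lra.
  - rewrite Rmax_left in Hc by lra; nra.
Qed.

(** * Growth of the hedge *)

Section Hedge.

Variable h : R -> R.
Hypotheses (h_even : even_function h) (h_C2 : C2 h)
  (h_0 : h 0 = 0) (h'_0 : Derive h 0 = 0) (h''_0 : Derive_n h 2 0 = 0)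
  (h''_incr : strictly_increasing_nonneg (Derive_n h 2))
  (h''_concave : concave_nonneg (Derive_n h 2)).

(** Both sides vanish to first order at [0], so that the comparison of the
    second derivatives decides. *)
Lemma h_scaling_ge s q x :
  0 <= s -> 0 <= x ->
  (forall t, 0 <= t -> q * Derive_n h 2 t <= s ^ 2 * Derive_n h 2 (s * t)) ->
  q * h x <= h (s * x).
Proof.
  intros Hs Hx H.
  destruct h_C2 as (E1 & E2 & _).
  assert (Hd1 : forall t, is_derive h t (Derive h t))
    by (intros; apply Derive_correct, E1).
  assert (Hd2 : forall t, is_derive (Derive h) t (Derive_n h 2 t))
    by (intros; apply Derive_correct, E2).
  assert (Hm : Rmin 0 x = 0 /\ Rmax 0 x = x)
    by (split; [apply Rmin_left|apply Rmax_right]; lra).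
  enough (0 <= h (s * x) - q * h x) by lra.
  apply (second_order_nonneg (fun t => h (s * t) - q * h t)
     (fun t => s * Derive h (s * t) - q * Derive h t)
     (fun t => s ^ 2 * Derive_n h 2 (s * t) - q * Derive_n h 2 t)).
  - intros t _.
    apply (is_derive_minus (fun t => h (s * t)) (fun t => q * h t)).
    + apply (is_derive_comp h (fun t => s * t) t (Derive h (s * t)) s); auto.
      auto_derive; auto; ring.
    + apply (is_derive_scal h t q); auto.
  - intros t _.
    apply (is_derive_minus (fun t => s * Derive h (s * t)) (fun t => q * Derive h t)).
    + replace (s ^ 2 * Derive_n h 2 (s * t)) with (s * (s * Derive_n h 2 (s * t))) by ring.
      apply (is_derive_scal (fun t => Derive h (s * t)) t s).
      apply (is_derive_comp (Derive h) (fun t => s * t) t (Derive_n h 2 (s * t)) s); auto.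
      auto_derive; auto; ring.
    + apply (is_derive_scal (Derive h) t q); auto.
  - intros t Ht; specialize (H t); lra.
  - rewrite Rmult_0_r, h_0; ring.
  - rewrite Rmult_0_r, h'_0; ring.
Qed.

Lemma h''_incr_le x y : 0 <= x -> x <= y -> Derive_n h 2 x <= Derive_n h 2 y.
Proof.
  intros H0 [H| ->]; [left; apply h''_incr; auto|right; reflexivity].
Qed.

Lemma h''_ge0 x : 0 <= x -> 0 <= Derive_n h 2 x.
Proof. intros H; rewrite <- h''_0; apply h''_incr_le; lra. Qed.

Lemma h_ge0 x : 0 <= h x.
Proof.
  assert (Hp : forall z, 0 <= z -> 0 <= h z).
  { intros z Hz; rewrite <- (Rmult_1_l z), <- (Rmult_0_l (h z)).
    apply h_scaling_ge; try lra; intros t Ht; rewrite Rmult_1_l, Rmult_0_l.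
    assert (H := h''_ge0 t Ht); lra. }
  destruct (Rle_lt_dec 0 x); auto.
  rewrite <- h_even; apply Hp; lra.
Qed.

(** Concavity of the second derivative: [h] grows at most like a cube. *)
Lemma h_contract s x : 0 <= s <= 1 -> 0 <= x -> s ^ 3 * h x <= h (s * x).
Proof.
  intros Hs Hx; apply h_scaling_ge; try lra; intros t Ht.
  assert (H := h''_concave t 0 s Ht (Rle_refl 0) Hs).
  rewrite h''_0 in H; replace (s * t + (1 - s) * 0) with (s * t) in H by ring.
  replace (s ^ 3 * Derive_n h 2 t) with (s ^ 2 * (s * Derive_n h 2 t)) by ring.
  apply Rmult_le_compat_l; [apply pow2_ge_0|lra].
Qed.

(** Monotonicity of the second derivative: [h] grows at least like a square. *)
Lemma h_dilate s x : 1 <= s -> 0 <= x -> s ^ 2 * h x <= h (s * x).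
Proof.
  intros Hs Hx; apply h_scaling_ge; try lra; intros t Ht.
  apply Rmult_le_compat_l; [apply pow2_ge_0|].
  apply h''_incr_le; auto.
  apply Rle_trans with (1 * t); [lra|apply Rmult_le_compat_r; lra].
Qed.

Lemma h_abs x : h (Rabs x) = h x.
Proof. unfold Rabs; destruct Rcase_abs; auto. Qed.

Lemma h_over_square_incr x y :
  0 < x -> x <= Rabs y -> (y / x) ^ 2 * h x <= h y.
Proof.
  intros Hx Hy.
  rewrite <- (h_abs y), <- (pow2_abs (y / x)).
  unfold Rdiv; rewrite Rabs_mult, (Rabs_right (/ x))
    by (left; apply Rinv_0_lt_compat; lra).
  replace (h (Rabs y)) with (h (Rabs y * / x * x))
    by (f_equal; field; lra).
  apply h_dilate; [|lra].
  apply Rmult_le_reg_r with x; auto.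
  rewrite Rmult_assoc, Rinv_l by lra; lra.
Qed.

Lemma h_incr x y : 0 <= x -> x <= y -> h x <= h y.
Proof.
  intros [Hx| <-] Hy; [|rewrite h_0; apply h_ge0].
  apply Rle_trans with ((y / x) ^ 2 * h x).
  - rewrite <- (Rmult_1_l (h x)) at 1.
    apply Rmult_le_compat_r; [apply h_ge0|].
    apply pow_R1_Rle.
    apply Rmult_le_reg_r with x; auto.
    unfold Rdiv; rewrite Rmult_assoc, Rinv_l by lra; lra.
  - apply h_over_square_incr; auto; rewrite Rabs_right; lra.
Qed.

Lemma h_pos x : 0 < x -> 0 < h x.
Proof.
  intros Hx.
  destruct h_C2 as (E1 & E2 & _).
  assert (Hp : forall F F', (forall t, is_derive F t (F' t)) -> F 0 = 0 ->
    (forall t, 0 < t -> 0 < F' t) -> forall z, 0 < z -> 0 < F z).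
  { intros F F' HF F0 HF' z Hz.
    destruct (MVT_cor2 F F' 0 z Hz) as (c & E & Hc).
    - intros t _; apply is_derive_Reals, HF.
    - assert (0 < F' c * (z - 0)) by (apply Rmult_lt_0_compat; [apply HF'|]; lra).
      lra. }
  apply (Hp h (Derive h)); auto.
  - intros; apply Derive_correct, E1.
  - apply (Hp (Derive h) (Derive_n h 2)); auto.
    + intros; apply Derive_correct, E2.
    + intros t Ht; rewrite <- h''_0; apply h''_incr; lra.
Qed.

End Hedge.

(** * Elementary inequalities *)

Lemma exp_half_le2 x : x <= / 2 -> exp x <= 2.
Proof.
  intros H.
  assert (exp (- x) * exp x = 1) by (rewrite <- exp_plus, Rplus_opp_l, exp_0; auto).
  assert (1 + - x <= exp (- x)) by (apply exp_ineq1_le).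
  assert (0 < exp x) by apply exp_pos; nra.
Qed.

Lemma exp_le_quadratic d u :
  0 <= d <= 1 -> u <= d / 2 -> exp u <= 1 + u + (1 + d) * u ^ 2 / 2.
Proof.
  intros Hd Hu.
  enough (0 <= 1 + u + (1 + d) * u ^ 2 / 2 - exp u) by lra.
  apply (second_order_nonneg (fun u => 1 + u + (1 + d) * u ^ 2 / 2 - exp u)
    (fun u => 1 + (1 + d) * u - exp u) (fun u => 1 + d - exp u)).
  - intros t _; auto_derive; auto; field.
  - intros t _; auto_derive; auto; field.
  - intros t Ht.
    assert (t <= d / 2)
      by (revert Ht; unfold Rmin, Rmax; repeat destruct Rle_dec; intros; lra).
    assert (exp (- t) * exp t = 1) by (rewrite <- exp_plus, Rplus_opp_l, exp_0; auto).
    assert (1 + - t <= exp (- t)) by (apply exp_ineq1_le).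
    assert (0 < exp t) by apply exp_pos; nra.
  - rewrite exp_0; field.
  - rewrite exp_0; field.
Qed.

Lemma exp_ge_quadratic d u :
  0 <= d -> - d <= u -> 1 + u + (1 - d) * u ^ 2 / 2 <= exp u.
Proof.
  intros Hd Hu.
  enough (0 <= exp u - (1 + u + (1 - d) * u ^ 2 / 2)) by lra.
  apply (second_order_nonneg (fun u => exp u - (1 + u + (1 - d) * u ^ 2 / 2))
    (fun u => exp u - (1 + (1 - d) * u)) (fun u => exp u - (1 - d))).
  - intros t _; auto_derive; auto; field.
  - intros t _; auto_derive; auto; field.
  - intros t Ht.
    assert (- d <= t)
      by (revert Ht; unfold Rmin, Rmax; repeat destruct Rle_dec; intros; lra).
    assert (1 + t <= exp t) by (apply exp_ineq1_le); lra.
  - rewrite exp_0; field.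
  - rewrite exp_0; field.
Qed.

(** The factor by which the capital changes when Skeptic bets [lam] on the
    increment and [(1 + d) * lam ^ 2 / 2] on its square; [u] stands for
    [lam * y] and [q] for [lam ^ 2 * v]. *)
Definition overhedge (d q u : R) : R := 1 + u + (1 + d) * (u ^ 2 - q) / 2.

Lemma overhedge_ge0 d q u :
  0 <= d <= 1 -> 0 <= q <= / 4 -> 0 <= overhedge d q u.
Proof.
  intros Hd Hq; unfold overhedge.
  assert (0 <= (1 + u) ^ 2) by apply pow2_ge_0.
  assert (0 <= d * u ^ 2) by (apply Rmult_le_pos; [lra|apply pow2_ge_0]).
  nra.
Qed.

Lemma overhedge_ge_exp d q u :
  0 < d <= / 2 -> 0 <= q <= d / 4 -> Rabs u <= d / 4 ->
  exp (u - (1 + 2 * d) * q / 2) <= overhedge d q u.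
Proof.
  intros Hd Hq Hu; apply Rabs_le_between in Hu.
  unfold overhedge, Rminus; rewrite exp_plus.
  set (c := (1 + 2 * d) * q / 2).
  assert (Hc : 0 <= c <= d / 4) by (unfold c; split; nra).
  assert (H1 := exp_le_quadratic d u ltac:(lra) ltac:(lra)).
  set (g := 1 + u + (1 + d) * u ^ 2 / 2) in *.
  assert (Hg : 1 - d / 4 <= g).
  { unfold g; assert (0 <= (1 + d) * u ^ 2) by (apply Rmult_le_pos; [lra|apply pow2_ge_0]).
    lra. }
  assert (H2 : exp (- c) * (1 + c) <= 1).
  { assert (exp c * exp (- c) = 1) by (rewrite <- exp_plus, Rplus_opp_r, exp_0; auto).
    assert (1 + c <= exp c) by apply exp_ineq1_le.
    assert (0 < exp (- c)) by apply exp_pos; nra. }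
  assert (He : 0 < exp (- c)) by apply exp_pos.
  apply Rle_trans with (g * exp (- c)); [apply Rmult_le_compat_r; lra|].
  replace (1 + u + (1 + d) * (u ^ 2 + - q) / 2) with (g - (1 + d) * q / 2)
    by (unfold g; field).
  apply Rmult_le_reg_r with (1 + c); [lra|].
  apply Rle_trans with g; [nra|].
  enough ((1 + d) * q / 2 * (1 + c) <= g * c) by lra.
  assert (H3 : (1 + d) * (1 + c) <= g * (1 + 2 * d)).
  { apply Rle_trans with ((1 + d) * (1 + d / 4)); [nra|].
    apply Rle_trans with ((1 - d / 4) * (1 + 2 * d)); nra. }
  replace (g * c) with (g * (1 + 2 * d) * (q / 2)) by (unfold c; field).
  replace ((1 + d) * q / 2 * (1 + c)) with ((1 + d) * (1 + c) * (q / 2)) by field.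
  apply Rmult_le_compat_r; lra.
Qed.

(** In the process that Skeptic is going to be short of, the third hedge, with payoff
    [z] and price [p], is sold: the factor is then bounded above. *)
Definition underhedge (d q p u z : R) : R :=
  1 + u + (1 - d) * (u ^ 2 - q) / 2 - (z - p).

Lemma underhedge_le2 d q p u z :
  0 < d <= / 2 -> 0 <= q -> p <= / 8 -> 0 <= z ->
  (d / 4 < Rabs u -> u ^ 2 <= z) -> underhedge d q p u z <= 2.
Proof.
  intros Hd Hq Hp Hz H; unfold underhedge.
  assert (Hu2 : 0 <= u ^ 2) by apply pow2_ge_0.
  assert (0 <= d * u ^ 2) by (apply Rmult_le_pos; lra).
  assert (0 <= (1 - d) * q) by (apply Rmult_le_pos; lra).
  destruct (Rle_lt_dec (Rabs u) (d / 4)) as [Hu|Hu].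
  - apply Rabs_le_between in Hu; nra.
  - specialize (H Hu); assert (0 <= (1 - u) ^ 2) by apply pow2_ge_0; nra.
Qed.

Lemma underhedge_ge0 d q p u z :
  0 < d <= / 2 -> 0 <= q <= / 4 -> 0 <= p -> z <= / 2 -> Rabs u <= d / 4 ->
  0 <= underhedge d q p u z.
Proof.
  intros Hd Hq Hp Hz Hu; unfold underhedge; apply Rabs_le_between in Hu.
  assert (0 <= (1 - d) * u ^ 2) by (apply Rmult_le_pos; [lra|apply pow2_ge_0]).
  nra.
Qed.

Lemma underhedge_le_exp d q p u z :
  0 < d <= / 2 -> 0 <= q -> 0 <= p -> 0 <= z -> Rabs u <= d / 4 ->
  underhedge d q p u z <= exp (u - (1 - 2 * d) * q / 2 + 2 * p).
Proof.
  intros Hd Hq Hp Hz Hu; unfold underhedge; apply Rabs_le_between in Hu.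
  assert (H1 := exp_ge_quadratic d u ltac:(lra) ltac:(lra)).
  assert (He : 0 < exp u) by apply exp_pos.
  assert (Hinv : exp u * exp (- u) = 1) by (rewrite <- exp_plus, Rplus_opp_r, exp_0; auto).
  assert (H2 : exp (- u) <= 2) by (apply exp_half_le2; lra).
  assert (H3 : 1 - d <= exp (- u)) by (assert (H := exp_ineq1_le (- u)); lra).
  replace (u - (1 - 2 * d) * q / 2 + 2 * p)
    with (u + (2 * p - (1 - 2 * d) * q / 2)) by ring.
  rewrite exp_plus.
  apply Rle_trans with (exp u * (1 + (2 * p - (1 - 2 * d) * q / 2))).
  - apply Rle_trans with (exp u + p - (1 - d) * q / 2); [lra|].
    assert (p <= exp u * (2 * p)) by nra.
    enough (exp u * ((1 - 2 * d) * q / 2) <= (1 - d) * q / 2) by lra.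
    apply Rle_trans with (exp u * ((1 - d) * exp (- u) * (q / 2))).
    + apply Rmult_le_compat_l; [lra|].
      replace ((1 - 2 * d) * q / 2) with ((1 - 2 * d) * (q / 2)) by field.
      apply Rmult_le_compat_r; nra.
    + right; replace (exp u * ((1 - d) * exp (- u) * (q / 2)))
        with (exp u * exp (- u) * ((1 - d) * (q / 2))) by ring.
      rewrite Hinv; field.
  - apply Rmult_le_compat_l; [lra|apply exp_ineq1_le].
Qed.

(** * Iterated logarithms and the size of the increments *)

Definition ll (X : R) : R := ln (ln X).
Definition jump_scale (X : R) : R := sqrt (X / ll X).
Definition lil_scale (X : R) : R := sqrt (2 * X * ll X).

Lemma ln_le_sub_1 x : 0 < x -> ln x <= x - 1.
Proof.
  intros Hx; assert (H := exp_ineq1_le (ln x)); rewrite exp_ln in H by auto; lra.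
Qed.

Lemma ll_ge C X : exp (exp C) <= X -> C <= ll X.
Proof.
  intros H; unfold ll.
  assert (H1 : exp C <= ln X).
  { rewrite <- (ln_exp (exp C)); apply ln_le; auto using exp_pos. }
  rewrite <- (ln_exp C); apply ln_le; auto using exp_pos.
Qed.

Lemma exp_exp_ge C : C < exp (exp C).
Proof.
  assert (H := exp_ineq1_le C); assert (H1 := exp_ineq1_le (exp C)).
  assert (H2 := exp_pos C); lra.
Qed.

Lemma ln_ge_1 X : exp (exp 1) <= X -> 1 <= ln X.
Proof.
  intros H; rewrite <- (ln_exp 1); apply ln_le; [apply exp_pos|].
  apply Rle_trans with (2 := H); left; apply exp_increasing.
  assert (H1 := exp_ineq1_le 1); lra.
Qed.

Lemma ll_incr X Y : exp (exp 1) <= X -> X <= Y -> ll X <= ll Y.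
Proof.
  intros H1 H2; unfold ll.
  assert (H3 := ln_ge_1 X H1); assert (H4 := exp_exp_ge 1).
  apply ln_le; [lra|apply ln_le; lra].
Qed.

Lemma ll_le_ln X : exp (exp 1) <= X -> ll X <= ln X.
Proof.
  intros H; unfold ll; assert (H3 := ln_ge_1 X H).
  assert (H4 := ln_le_sub_1 (ln X) ltac:(lra)); lra.
Qed.

Lemma ll_eventually_ge C : Rbar_locally p_infty (fun X => C <= ll X).
Proof. exists (exp (exp C)); intros X H; apply ll_ge; lra. Qed.

Lemma ll_eventually_small eps :
  0 < eps -> Rbar_locally p_infty (fun X => ll X <= eps * X).
Proof.
  intros He; exists (Rmax (exp (exp 1)) (4 / eps ^ 2)); intros X HX.
  assert (H1 : exp (exp 1) <= X) by (apply Rle_trans with (2 := Rlt_le _ _ HX), Rmax_l).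
  assert (H2 : 4 / eps ^ 2 <= X) by (apply Rle_trans with (2 := Rlt_le _ _ HX), Rmax_r).
  assert (H0 := exp_exp_ge 1).
  apply Rle_trans with (1 := ll_le_ln X H1).
  assert (Hs : 0 < sqrt X) by (apply sqrt_lt_R0; lra).
  assert (E : sqrt X * sqrt X = X) by (apply sqrt_sqrt; lra).
  assert (E1 : ln X = 2 * ln (sqrt X)) by (rewrite <- E at 1; rewrite ln_mult by auto; ring).
  assert (H3 := ln_le_sub_1 (sqrt X) Hs).
  assert (H4 : 2 / eps <= sqrt X).
  { rewrite <- (sqrt_pow2 (2 / eps)).
    - apply sqrt_le_1_alt; replace ((2 / eps) ^ 2) with (4 / eps ^ 2) by (field; lra); auto.
    - left; apply Rdiv_lt_0_compat; lra. }
  assert (H5 : 2 <= eps * sqrt X).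
  { replace 2 with (eps * (2 / eps)) by (field; lra); apply Rmult_le_compat_l; lra. }
  rewrite <- E at 2; rewrite <- Rmult_assoc.
  assert (2 * sqrt X <= eps * sqrt X * sqrt X) by (apply Rmult_le_compat_r; lra).
  lra.
Qed.

(** Since [ln s <= s - 1], multiplying [X] by [s >= 1] multiplies [ll X] by at most
    [s]. *)
Lemma ratio_incr X Y : exp (exp 1) <= X -> X <= Y -> X / ll X <= Y / ll Y.
Proof.
  intros HX HY.
  assert (H0 := exp_exp_ge 1); assert (H1 := ln_ge_1 X HX).
  assert (H2 := ll_ge 1 X HX); assert (H3 := ll_incr X Y HX HY).
  set (s := Y / X).
  assert (Hs : 1 <= s).
  { unfold s; apply Rmult_le_reg_r with X; [lra|].
    unfold Rdiv; rewrite Rmult_assoc, Rinv_l; lra. }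
  assert (EY : Y = X * s) by (unfold s; field; lra).
  assert (Hls : 0 <= ln s) by (rewrite <- ln_1; apply ln_le; lra).
  assert (H4 : ll Y <= s * ll X).
  { unfold ll at 1; rewrite EY, ln_mult by lra.
    apply Rle_trans with (ln (ln X * (1 + ln s))); [apply ln_le; nra|].
    rewrite ln_mult by lra.
    assert (H5 := ln_le_sub_1 (1 + ln s) ltac:(lra)).
    assert (H6 := ln_le_sub_1 s ltac:(lra)).
    change (ln (ln X)) with (ll X); nra. }
  apply Rmult_le_reg_r with (ll X * ll Y); [apply Rmult_lt_0_compat; lra|].
  replace (X / ll X * (ll X * ll Y)) with (X * ll Y) by (field; lra).
  replace (Y / ll Y * (ll X * ll Y)) with (Y * ll X) by (field; lra).
  rewrite EY at 2; rewrite Rmult_assoc; apply Rmult_le_compat_l; lra.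
Qed.

Lemma jump_scale_incr X Y :
  exp (exp 1) <= X -> X <= Y -> jump_scale X <= jump_scale Y.
Proof. intros; apply sqrt_le_1_alt, ratio_incr; auto. Qed.

Lemma jump_scale_pos X : exp (exp 1) <= X -> 0 < jump_scale X.
Proof.
  intros HX; assert (H0 := exp_exp_ge 1); assert (H2 := ll_ge 1 X HX).
  apply sqrt_lt_R0, Rdiv_lt_0_compat; lra.
Qed.

Lemma jump_scale_eventually_ge C :
  Rbar_locally p_infty (fun X => C <= jump_scale X).
Proof.
  assert (HC : 0 < Rabs C + 1) by (assert (H := Rabs_pos C); lra).
  assert (H : 0 < / (Rabs C + 1) ^ 2) by (apply Rinv_0_lt_compat, pow_lt; auto).
  apply (filter_imp (fun X => ll X <= / (Rabs C + 1) ^ 2 * X /\ 1 <= ll X)).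
  - intros X [H1 H2].
    apply Rle_trans with (Rabs C + 1); [assert (H3 := Rle_abs C); lra|].
    rewrite <- (sqrt_pow2 (Rabs C + 1)) by lra.
    apply sqrt_le_1_alt.
    apply Rmult_le_reg_r with (ll X); [lra|].
    replace (X / ll X * ll X) with X by (field; lra).
    apply Rmult_le_reg_l with (/ (Rabs C + 1) ^ 2); auto.
    rewrite <- Rmult_assoc, Rinv_l by (apply pow_nonzero; lra); lra.
  - apply filter_and; [apply ll_eventually_small; auto|apply ll_eventually_ge].
Qed.

Lemma eventually_INR (P : R -> Prop) :
  Rbar_locally p_infty P -> exists N, forall n, (N <= n)%nat -> P (INR n).
Proof. intros H; exact (is_lim_seq_INR P H). Qed.

(** The increments are of smaller order than the scale [sqrt (n / ln (ln n))] at
    which the exponential bets cease to be approximated by quadratic ones. *)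
Definition moderate (y : nat -> R) : Prop :=
  forall d, 0 < d ->
  exists N, forall n, (N <= n)%nat -> Rabs (y n) <= d * jump_scale (INR n).

Lemma moderate_uniform y d :
  moderate y -> 0 < d ->
  Rbar_locally p_infty (fun X => forall i, INR i <= X -> Rabs (y i) <= d * jump_scale X).
Proof.
  intros Hy Hd; destruct (Hy d Hd) as [N HN].
  destruct (INR_unbounded (exp (exp 1))) as [N1 HN1].
  set (p := Nat.max N N1).
  apply (filter_imp (fun X =>
    partial_sum (fun i => Rabs (y i)) p / d <= jump_scale X)).
  - intros X HX i Hi.
    destruct (Nat.lt_ge_cases i p) as [H|H].
    + apply Rle_trans with (partial_sum (fun i => Rabs (y i)) p).
      * apply (partial_sum_term_le (fun i => Rabs (y i))); auto using Rabs_pos.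
      * apply Rmult_le_reg_l with (/ d); [apply Rinv_0_lt_compat; auto|].
        rewrite <- Rmult_assoc, Rinv_l, Rmult_1_l by lra.
        rewrite Rmult_comm; exact HX.
    + apply Rle_trans with (1 := HN i ltac:(unfold p in H; lia)).
      apply Rmult_le_compat_l; [lra|apply jump_scale_incr; auto].
      assert (INR N1 <= INR i) by (apply le_INR; unfold p in H; lia); lra.
  - apply jump_scale_eventually_ge.
Qed.

Fixpoint tickets (phi : R -> R) (pr : R) (N : nat) (b : nat -> R) (l : list R) : R :=
  match l with
  | [] => 1
  | y :: l' => tickets phi pr N b l'
      + (if le_lt_dec N (length l') then b (length l') else 0) * (phi y - pr)
  end.

Lemma tickets_past phi pr N b y n :
  tickets phi pr N b (past y n) = 1
    + partial_sum (fun k => (if le_lt_dec N k then b k else 0) * phi (y k)) n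
    - pr * partial_sum (fun k => if le_lt_dec N k then b k else 0) n.
Proof.
  induction n as [|n IH]; simpl; [ring|].
  rewrite IH, length_past; ring.
Qed.

Lemma tickets_capital_process h v w phi pr N b :
  hedgeable h v w (fun y => phi y - pr) ->
  (forall y, 0 <= phi y) -> (forall k, 0 <= b k) ->
  (forall n, pr * partial_sum (fun k => if le_lt_dec N k then b k else 0) n <= 1) ->
  capital_process h v w N (tickets phi pr N b).
Proof.
  intros Hh Hphi Hb Hs.
  assert (Hc : forall n, 0 <= (if le_lt_dec N n then b n else 0))
    by (intros n; destruct le_lt_dec; auto; lra).
  split; [|split].
  - intros l; apply hedgeable_le with (2 := hedgeable_scal h v w _ _ (Hc (length l)) Hh).
    intros y; simpl; lra.
  - intros l.
    apply Rle_trans with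
      (1 - pr * partial_sum (fun k => if le_lt_dec N k then b k else 0) (length l));
      [specialize (Hs (length l)); lra|].
    clear Hs; induction l as [|y l IH]; simpl; [lra|].
    assert (H := Rmult_le_pos _ _ (Hc (length l)) (Hphi y)); lra.
  - induction l as [|y l IH]; simpl; intros Hl; auto.
    rewrite IH by lia; destruct le_lt_dec; [lia|ring].
Qed.

Section Truncation.

Variables (h : R -> R) (v w : R).
Hypotheses (h_even : even_function h) (h_C2 : C2 h)
  (h_0 : h 0 = 0) (h'_0 : Derive h 0 = 0) (h''_0 : Derive_n h 2 0 = 0)
  (h''_incr : strictly_increasing_nonneg (Derive_n h 2))
  (h''_concave : concave_nonneg (Derive_n h 2))
  (h_summable :
     ex_series (fun k : nat =>
       let n := INR (k + 3) in / h (sqrt (n / ln (ln n)))))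
  (w_ge0 : 0 <= w).

Lemma inv_h_ge0 x : 0 <= / h x.
Proof.
  assert (H : 0 <= h x) by (apply h_ge0; auto).
  destruct H as [H|<-]; [left; apply Rinv_0_lt_compat; auto|rewrite Rinv_0; lra].
Qed.

Lemma summable_bound :
  exists B, forall n, partial_sum (fun k => / h (jump_scale (INR (k + 3)))) n <= B.
Proof.
  destruct h_summable as [B HB]; exists B; intros n.
  assert (E : forall n, partial_sum (fun k => / h (jump_scale (INR (k + 3)))) (S n)
    = sum_n (fun k => / h (sqrt (INR (k + 3) / ln (ln (INR (k + 3)))))) n).
  { induction n0 as [|n0 IH].
    - rewrite sum_O; simpl; unfold jump_scale, ll; ring.
    - rewrite sum_Sn, <- IH; reflexivity. }
  apply Rle_trans with (partial_sum (fun k => / h (jump_scale (INR (k + 3)))) (S n)).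
  - apply partial_sum_incr; [intros; apply inv_h_ge0|lia].
  - rewrite E; apply (is_lim_seq_incr_compare
      (sum_n (fun k => / h (sqrt (INR (k + 3) / ln (ln (INR (k + 3)))))))).
    + exact HB.
    + intros k; rewrite sum_Sn; assert (H := inv_h_ge0 (jump_scale (INR (S k + 3)))).
      unfold plus; simpl plus; unfold jump_scale, ll in H; simpl in *; lra.
Qed.

(** Shrinking the argument by the factor [d] divides [h] by [d ^ 3] at most, so the
    series converges for every [d]. *)
Lemma jump_price_bound d N :
  0 < d <= 1 -> exp (exp 1) <= INR N -> (3 <= N)%nat ->
  exists B, forall n,
    partial_sum (fun k => if le_lt_dec N k then / h (d * jump_scale (INR k)) else 0) n <= B.
Proof.
  intros Hd HN H3; destruct summable_bound as [B HB].
  exists (/ d ^ 3 * B); intros n.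
  set (f := fun k => if le_lt_dec N k then / h (d * jump_scale (INR k)) else 0).
  assert (Hf : forall k, 0 <= f k)
    by (intros k; unfold f; destruct le_lt_dec; [apply inv_h_ge0|lra]).
  assert (Hd3 : 0 < d ^ 3) by (apply pow_lt; lra).
  apply Rle_trans with (partial_sum f (3 + n)); [apply partial_sum_incr; auto; lia|].
  rewrite partial_sum_shift.
  replace (partial_sum f 3) with 0
    by (simpl; unfold f; repeat destruct le_lt_dec; try lia; ring).
  rewrite Rplus_0_l.
  apply Rle_trans with
    (partial_sum (fun k => / d ^ 3 * / h (jump_scale (INR (k + 3)))) n).
  - apply partial_sum_le; intros k _; unfold f.
    rewrite (Nat.add_comm 3 k); destruct (le_lt_dec N (k + 3)) as [H|H].
    + assert (Hj : 0 < jump_scale (INR (k + 3))).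
      { apply jump_scale_pos; apply Rle_trans with (1 := HN), le_INR; auto. }
      assert (Hp : 0 < h (jump_scale (INR (k + 3)))) by (apply h_pos; auto).
      rewrite <- Rinv_mult; apply Rinv_le_contravar; [apply Rmult_lt_0_compat; auto|].
      apply h_contract; auto; lra.
    + apply Rmult_le_pos; [left; apply Rinv_0_lt_compat; auto|apply inv_h_ge0].
  - rewrite partial_sum_scal; apply Rmult_le_compat_l; auto.
    left; apply Rinv_0_lt_compat; auto.
Qed.

(** Tickets that pay when round [k] has a large increment, each of price
    proportional to [/ h (d * jump_scale k)]: the total price is finite. *)
Lemma null_jumps d :
  0 < d <= 1 ->
  null h v w (fun y => forall N, exists n, (N <= n)%nat
    /\ d * jump_scale (INR n) < Rabs (y n)).
Proof.
  intros Hd N0.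
  destruct (INR_unbounded (exp (exp 1))) as [N1 HN1].
  set (N := Nat.max (Nat.max N0 N1) 3).
  assert (HN : exp (exp 1) <= INR N).
  { assert (INR N1 <= INR N) by (apply le_INR; unfold N; lia); lra. }
  destruct (jump_price_bound d N Hd HN ltac:(unfold N; lia)) as [B HB].
  assert (HB0 : 0 <= B) by exact (HB 0%nat).
  set (c := / (w * B + 1)).
  assert (HwB : 0 <= w * B) by (apply Rmult_le_pos; auto).
  assert (Hc : 0 < c) by (apply Rinv_0_lt_compat; lra).
  assert (Ec : c * (w * B + 1) = 1) by (unfold c; rewrite Rinv_l; lra).
  set (b := fun k => c * / h (d * jump_scale (INR k))).
  assert (Hb : forall k, 0 <= b k) by (intros; apply Rmult_le_pos; [lra|apply inv_h_ge0]).
  assert (Hs : forall n, w * partial_sum (fun k => if le_lt_dec N k then b k else 0) n <= 1).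
  { intros n; rewrite (partial_sum_ext _ (fun k => c *
      (if le_lt_dec N k then / h (d * jump_scale (INR k)) else 0)))
      by (intros; unfold b; destruct le_lt_dec; ring).
    rewrite partial_sum_scal; specialize (HB n).
    apply Rle_trans with (w * (c * B)); [|lra].
    apply Rmult_le_compat_l; auto; apply Rmult_le_compat_l; lra. }
  exists (tickets h w N b); split.
  - apply capital_process_le with N; [unfold N; lia|].
    apply tickets_capital_process; auto; [|intros; apply h_ge0; auto].
    exists (Stake 0 0 1); intros y; unfold gain; simpl; rewrite Rminus_0_r; lra.
  - intros y Hy C.
    set (r := fun k => (if le_lt_dec N k then b k else 0) * h (y k)).
    assert (Hr : forall k, 0 <= r k).
    { intros k; apply Rmult_le_pos; [destruct le_lt_dec; auto; lra|apply h_ge0; auto]. }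
    assert (Hcount : forall q : nat, exists n, c * INR q <= partial_sum r n).
    { induction q as [|q [n IH]]; [exists 0%nat; simpl; lra|].
      destruct (Hy (Nat.max n N)) as (k & Hk & Hjump).
      exists (S k); rewrite S_INR.
      assert (H1 := partial_sum_incr r n k Hr ltac:(lia)).
      assert (H2 : c <= r k).
      { unfold r, b; destruct le_lt_dec; [|lia].
        assert (Hj : 0 < jump_scale (INR k)).
        { apply jump_scale_pos; apply Rle_trans with (1 := HN), le_INR; lia. }
        assert (Hp : 0 < h (d * jump_scale (INR k)))
          by (apply h_pos; auto; apply Rmult_lt_0_compat; lra).
        rewrite <- (Rmult_1_r c) at 1; rewrite Rmult_assoc.
        apply Rmult_le_compat_l; [lra|].
        apply Rmult_le_reg_l with (h (d * jump_scale (INR k))); auto.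
        rewrite <- Rmult_assoc, Rinv_r by lra; rewrite Rmult_1_l, Rmult_1_r.
        rewrite <- (h_abs h h_even (y k)).
        apply h_incr; auto; [apply Rmult_le_pos|]; lra. }
      simpl; lra. }
    destruct (INR_unbounded (C / c)) as [q Hq].
    destruct (Hcount q) as [n Hn].
    exists n; rewrite tickets_past; fold r.
    assert (C < c * INR q).
    { replace C with (c * (C / c)) by (field; lra); apply Rmult_lt_compat_l; auto. }
    specialize (Hs n); lra.
Qed.

Lemma null_not_moderate : null h v w (fun y => ~ moderate y).
Proof.
  apply null_incl with (fun y => exists j, forall N, exists n, (N <= n)%nat
    /\ / INR (S j) * jump_scale (INR n) < Rabs (y n)).
  - intros y Hy; apply not_all_ex_not in Hy; destruct Hy as [d Hd].
    apply imply_to_and in Hd; destruct Hd as [Hd H].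
    destruct (INR_unbounded (/ d)) as [j Hj].
    assert (Hj0 : 0 < INR j) by (assert (H1 := Rinv_0_lt_compat d Hd); lra).
    exists j; intros N.
    apply not_ex_all_not with (n := N) in H; apply not_all_ex_not in H.
    destruct H as [n H]; apply imply_to_and in H; destruct H as [H1 H2].
    exists n; split; auto; apply Rnot_le_lt in H2.
    apply Rle_lt_trans with (2 := H2).
    apply Rmult_le_compat_r; [apply sqrt_pos|].
    rewrite S_INR, <- (Rinv_inv d); apply Rinv_le_contravar; [|lra].
    apply Rinv_0_lt_compat; auto.
  - apply (null_union h v w (fun j y => forall N, exists n, (N <= n)%nat
      /\ / INR (S j) * jump_scale (INR n) < Rabs (y n))).
    intros j; apply null_jumps.
    assert (H : 1 <= INR (S j)) by (rewrite S_INR; assert (H := pos_INR j); lra).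
    split; [apply Rinv_0_lt_compat; lra|].
    rewrite <- Rinv_1; apply Rinv_le_contravar; lra.
Qed.

End Truncation.

(** * The upper half *)

Lemma ln_div_pred k : (2 <= k)%nat -> / INR k <= ln (INR k) - ln (INR (k - 1)).
Proof.
  intros Hk; rewrite minus_INR by lia; simpl (INR 1).
  assert (H : 2 <= INR k) by (apply (le_INR 2); auto).
  assert (Hp : 0 < (INR k - 1) / INR k) by (apply Rdiv_lt_0_compat; lra).
  assert (H1 := ln_le_sub_1 _ Hp).
  rewrite ln_div in H1 by lra.
  replace ((INR k - 1) / INR k - 1) with (- / INR k) in H1 by (field; lra).
  lra.
Qed.

(** Comparison with the telescoping series of [n |-> n ^ - e]. *)
Lemma power_series_bound e :
  0 < e -> exists B, forall n, partial_sum (fun k => exp (- (1 + e) * ln (INR k))) n <= B.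
Proof.
  intros He.
  set (t := fun k => exp (- (1 + e) * ln (INR k))).
  set (b := fun k => exp (- e * ln (INR k))).
  assert (Ht : forall k, 0 <= t k) by (intros; left; apply exp_pos).
  assert (Hstep : forall k, (2 <= k)%nat -> t k <= / e * (b (k - 1)%nat - b k)).
  { intros k Hk.
    assert (H : 2 <= INR k) by (apply (le_INR 2); auto).
    assert (E1 : t k = b k * / INR k).
    { unfold t, b; replace (- (1 + e) * ln (INR k)) with (- e * ln (INR k) + - ln (INR k)) by ring.
      rewrite exp_plus, exp_Ropp, exp_ln by lra; reflexivity. }
    assert (E2 : b (k - 1)%nat = b k * exp (e * (ln (INR k) - ln (INR (k - 1))))).
    { unfold b; rewrite <- exp_plus; f_equal; ring. }
    assert (H1 := exp_ineq1_le (e * (ln (INR k) - ln (INR (k - 1))))).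
    assert (H2 := ln_div_pred k Hk).
    assert (Hb : 0 < b k) by apply exp_pos.
    assert (H3 : e * / INR k <= e * (ln (INR k) - ln (INR (k - 1))))
      by (apply Rmult_le_compat_l; lra).
    apply Rmult_le_reg_l with e; auto.
    rewrite <- Rmult_assoc, Rinv_r, Rmult_1_l by lra.
    rewrite E1, E2.
    apply Rle_trans with (b k * (1 + e * / INR k) - b k); [lra|].
    apply Rplus_le_compat_r, Rmult_le_compat_l; lra. }
  exists (t 0%nat + t 1%nat + / e * b 1%nat); intros n.
  apply Rle_trans with (partial_sum t (2 + n)); [apply partial_sum_incr; auto; lia|].
  apply Rle_trans with (t 0%nat + t 1%nat + / e * (b 1%nat - b (1 + n)%nat)).
  - induction n as [|n IH]; [simpl; lra|].
    rewrite Nat.add_succ_r; simpl partial_sum at 1.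
    specialize (Hstep (2 + n)%nat ltac:(lia)).
    change (2 + n - 1)%nat with (1 + n)%nat in Hstep.
    change (partial_sum t n + t n + t (S n)) with (partial_sum t (2 + n)).
    rewrite Nat.add_succ_r; change (S (1 + n)) with (2 + n)%nat.
    change (S (S n)) with (2 + n)%nat; lra.
  - assert (0 < / e * b (1 + n)%nat)
      by (apply Rmult_lt_0_compat; [apply Rinv_0_lt_compat; auto|apply exp_pos]).
    lra.
Qed.

Section Exponential.

Variables (h : R -> R) (v w : R).

(** The counterpart of an exponential supermartingale, started in round [N]. *)
Fixpoint overcap (N : nat) (d lam : R) (l : list R) : R :=
  match l with
  | [] => 1
  | y :: l' => overcap N d lam l' *
      (if le_lt_dec N (length l') then overhedge d (lam ^ 2 * v) (lam * y) else 1)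
  end.

Lemma overcap_ge0 N d lam l :
  0 <= d <= 1 -> 0 <= lam ^ 2 * v <= / 4 -> 0 <= overcap N d lam l.
Proof.
  intros Hd Hq; induction l as [|y l IH]; simpl; [lra|].
  apply Rmult_le_pos; auto; destruct le_lt_dec; [apply overhedge_ge0; auto|lra].
Qed.

Lemma overcap_idle N d lam l : (length l <= N)%nat -> overcap N d lam l = 1.
Proof.
  induction l as [|y l IH]; simpl; intros H; auto.
  rewrite IH by lia; destruct le_lt_dec; [lia|ring].
Qed.

Lemma overcap_capital_process N d lam :
  0 <= d <= 1 -> 0 <= lam ^ 2 * v <= / 4 ->
  capital_process h v w N (overcap N d lam).
Proof.
  intros Hd Hq; split; [|split].
  - intros l; set (K := overcap N d lam l).
    destruct (le_lt_dec N (length l)) as [H|H].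
    + exists (Stake (K * lam) (K * ((1 + d) / 2 * lam ^ 2)) 0); intros y; simpl; fold K.
      destruct le_lt_dec; [|lia].
      unfold gain, overhedge; simpl; rewrite Rminus_0_r; lra.
    + apply hedgeable_le with (2 := hedgeable_0 h v w); intros y; simpl; fold K.
      destruct le_lt_dec; [lia|lra].
  - intros l; apply overcap_ge0; auto.
  - apply overcap_idle.
Qed.

Lemma overcap_ge_exp N d lam y n :
  0 < d <= / 2 -> 0 <= lam ^ 2 * v <= d / 4 -> (N <= n)%nat ->
  (forall i, (N <= i < n)%nat -> Rabs (lam * y i) <= d / 4) ->
  exp (lam * (partial_sum y n - partial_sum y N)
       - (1 + 2 * d) * (lam ^ 2 * v) / 2 * (INR n - INR N))
    <= overcap N d lam (past y n).
Proof.
  intros Hd Hq Hn; induction Hn as [|n Hn IH]; intros Hy.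
  - rewrite !Rminus_diag, !Rmult_0_r, Rminus_0_r, exp_0.
    rewrite overcap_idle by (rewrite length_past; auto); lra.
  - cbn [past overcap]; rewrite length_past.
    destruct le_lt_dec; [|lia].
    replace (lam * (partial_sum y (S n) - partial_sum y N)
       - (1 + 2 * d) * (lam ^ 2 * v) / 2 * (INR (S n) - INR N))
      with ((lam * (partial_sum y n - partial_sum y N)
       - (1 + 2 * d) * (lam ^ 2 * v) / 2 * (INR n - INR N))
       + (lam * y n - (1 + 2 * d) * (lam ^ 2 * v) / 2))
      by (rewrite S_INR; simpl; field).
    rewrite exp_plus; apply Rmult_le_compat; try (left; apply exp_pos).
    + apply IH; intros i Hi; apply Hy; lia.
    + apply overhedge_ge_exp; auto; apply Hy; lia.
Qed.

End Exponential.

(** The margin by which a quadratic in [s = sqrt (n / X)], maximal near [s = 1],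
    exceeds the exponent that is needed for summability. *)
Lemma upper_exponent e s :
  0 < e <= 1 -> 1 - e / 8 <= s <= 1 ->
  1 + e <= 2 * (1 + e) * (1 - e / 8) * s - (1 + 2 * (e / 16)) * s ^ 2.
Proof.
  intros He Hs.
  apply Rle_trans with (s * (2 * (1 + e) * (1 - e / 8) - (1 + 2 * (e / 16)))).
  - apply Rle_trans with ((1 - e / 8) * (2 * (1 + e) * (1 - e / 8) - (1 + 2 * (e / 16)))).
    + assert (e * e <= e) by nra; assert (0 <= e * e * e) by (repeat apply Rmult_le_pos; lra).
      nra.
    + apply Rmult_le_compat_r; nra.
  - assert (s ^ 2 <= s) by nra; nra.
Qed.

Lemma exp_beats_power c v :
  0 < c -> 0 < v ->
  exists N, forall k, (N <= k)%nat -> 2 * (c * INR k) * INR k ^ 4 <= v * exp (c * INR k).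
Proof.
  intros Hc Hv.
  destruct (INR_unbounded (2 * c / (v * (c / 6) ^ 6))) as [N HN].
  exists N; intros k Hk.
  assert (Hc6 : 0 < v * (c / 6) ^ 6) by (apply Rmult_lt_0_compat; auto; apply pow_lt; lra).
  assert (H1 : 2 * c <= v * (c / 6) ^ 6 * INR k).
  { apply le_INR in Hk.
    replace (2 * c) with (v * (c / 6) ^ 6 * (2 * c / (v * (c / 6) ^ 6))) by (field; lra).
    apply Rmult_le_compat_l; lra. }
  assert (Hk0 := pos_INR k).
  apply Rle_trans with (v * (c / 6 * INR k) ^ 6).
  - replace (2 * (c * INR k) * INR k ^ 4) with (2 * c * INR k ^ 5) by ring.
    replace (v * (c / 6 * INR k) ^ 6) with (v * (c / 6) ^ 6 * INR k * INR k ^ 5) by ring.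
    apply Rmult_le_compat_r; auto; apply pow_le; auto.
  - apply Rmult_le_compat_l; [lra|].
    assert (E : exp (c * INR k) = exp (c / 6 * INR k) ^ 6).
    { simpl; rewrite Rmult_1_r, <- !exp_plus; f_equal; field. }
    rewrite E; apply pow_incr; split; [apply Rmult_le_pos; lra|].
    assert (H := exp_ineq1_le (c / 6 * INR k)); lra.
Qed.

Lemma partial_sum_abs_le y b n :
  (forall i, (i < n)%nat -> Rabs (y i) <= b) -> Rabs (partial_sum y n) <= INR n * b.
Proof.
  induction n as [|n IH]; intros H; [simpl; rewrite Rabs_R0; lra|].
  cbn [partial_sum]; rewrite S_INR.
  apply Rle_trans with (1 := Rabs_triang _ _).
  assert (H1 := IH (fun i Hi => H i ltac:(lia))).
  assert (H2 := H n ltac:(lia)); lra.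
Qed.

Lemma jump_scale_le_self X : exp (exp 1) <= X -> jump_scale X <= X.
Proof.
  intros H; assert (H0 := exp_exp_ge 1); assert (H1 := ll_ge 1 X H).
  unfold jump_scale; rewrite <- (sqrt_pow2 X) at 3 by lra.
  apply sqrt_le_1_alt.
  apply Rmult_le_reg_r with (ll X); [lra|].
  replace (X / ll X * ll X) with X by (field; lra).
  assert (X * 1 <= X ^ 2) by nra; nra.
Qed.

Lemma exp_le_mono x y : x <= y -> exp x <= exp y.
Proof. intros [H| ->]; [left; apply exp_increasing; auto|apply Rle_refl]. Qed.

Lemma grid_point c x : 0 < c -> 1 <= x ->
  exists k, exp (c * INR k) <= x * exp c /\ x <= exp (c * INR k).
Proof.
  intros Hc Hx.
  assert (Hl : 0 <= ln x) by (rewrite <- ln_1; apply ln_le; lra).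
  destruct (nfloor_ex (ln x / c)) as [m Hm];
    [apply Rmult_le_pos; auto; left; apply Rinv_0_lt_compat; auto|].
  exists (S m); rewrite S_INR.
  assert (E : ln x = c * (ln x / c)) by (field; lra).
  rewrite <- (exp_ln x) by lra; rewrite <- exp_plus; split; apply exp_le_mono; nra.
Qed.

Lemma exp_step_lim c : 0 < c -> is_lim_seq (fun k => exp (c * INR k)) p_infty.
Proof.
  intros Hc; apply (is_lim_seq_le_p_loc (fun k => c * INR k)).
  - exists 0%nat; intros n _; assert (H := exp_ineq1_le (c * INR n)); lra.
  - replace p_infty with (Rbar_mult c p_infty)
      by (simpl; destruct Rle_dec; [destruct Rle_lt_or_eq_dec|]; auto; exfalso; lra).
    apply is_lim_seq_scal_l, is_lim_seq_INR.
Qed.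

Section Upper.

Variables (h : R -> R) (v w : R).
Hypothesis v_pos : 0 < v.

(** The rate that maximises [lam * S - lam ^ 2 * v * X / 2] at time [X] for the sum
    [S = sqrt v * lil_scale X]; the maximum is [ll X]. *)
Definition lil_rate (X : R) : R := sqrt (2 * ll X / (v * X)).

Lemma lil_rate_sqr X : 0 < X -> 0 <= ll X -> lil_rate X ^ 2 * v = 2 * ll X / X.
Proof.
  intros HX HL; unfold lil_rate; rewrite pow2_sqrt; [field; lra|].
  apply Rmult_le_pos; [lra|left; apply Rinv_0_lt_compat, Rmult_lt_0_compat; lra].
Qed.

Lemma lil_rate_jump_scale X :
  0 < X -> 0 < ll X -> lil_rate X * jump_scale X = sqrt (2 / v).
Proof.
  intros HX HL; unfold lil_rate, jump_scale; rewrite <- sqrt_mult_alt.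
  - f_equal; field; lra.
  - apply Rmult_le_pos; [lra|left; apply Rinv_0_lt_compat, Rmult_lt_0_compat; lra].
Qed.

Lemma lil_rate_lil_scale X n :
  0 < X -> 0 <= n -> 0 <= ll X -> 0 <= ll n ->
  lil_rate X * (sqrt v * lil_scale n) = 2 * (sqrt (n / X) * sqrt (ll X * ll n)).
Proof.
  intros HX Hn H1 H2; unfold lil_rate, lil_scale.
  assert (Hq : 0 <= 2 * ll X / (v * X))
    by (apply Rmult_le_pos; [lra|left; apply Rinv_0_lt_compat, Rmult_lt_0_compat; lra]).
  assert (Hx : 0 <= n / X)
    by (apply Rmult_le_pos; [lra|left; apply Rinv_0_lt_compat; lra]).
  rewrite <- (sqrt_mult_alt v), <- (sqrt_mult_alt (2 * ll X / (v * X))),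
    <- (sqrt_mult_alt (n / X)) by lra.
  rewrite <- (sqrt_pow2 2) at 3 by lra.
  rewrite <- sqrt_mult_alt by lra.
  f_equal; field; lra.
Qed.

Lemma moderate_rate y d :
  moderate y -> 0 < d ->
  Rbar_locally p_infty (fun X => forall i, INR i <= X -> lil_rate X * Rabs (y i) <= d).
Proof.
  intros Hy Hd.
  assert (Hs : 0 < sqrt (2 / v)) by (apply sqrt_lt_R0, Rdiv_lt_0_compat; lra).
  apply (filter_imp (fun X => (forall i, INR i <= X ->
    Rabs (y i) <= d / sqrt (2 / v) * jump_scale X) /\ 1 <= ll X /\ exp (exp 1) <= X)).
  - intros X (H1 & H2 & H3) i Hi; assert (H0 := exp_exp_ge 1).
    apply Rle_trans with (lil_rate X * (d / sqrt (2 / v) * jump_scale X)).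
    + apply Rmult_le_compat_l; [apply sqrt_pos|auto].
    + right; rewrite <- lil_rate_jump_scale with (X := X) by lra.
      assert (0 < jump_scale X) by (apply jump_scale_pos; auto).
      assert (E := lil_rate_jump_scale X ltac:(lra) ltac:(lra)).
      field; split; [|intros Z; rewrite Z in E]; lra.
  - repeat apply filter_and.
    + apply moderate_uniform; auto; apply Rdiv_lt_0_compat; auto.
    + apply ll_eventually_ge.
    + exists (exp (exp 1)); intros; lra.
Qed.

Lemma rate_eventually_small d :
  0 < d -> Rbar_locally p_infty (fun X => 0 <= lil_rate X ^ 2 * v <= d).
Proof.
  intros Hd.
  apply (filter_imp (fun X => ll X <= d / 2 * X /\ 1 <= ll X /\ exp (exp 1) <= X)).
  - intros X (H1 & H2 & H3); assert (H0 := exp_exp_ge 1).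
    rewrite lil_rate_sqr by lra; split.
    + apply Rmult_le_pos; [lra|left; apply Rinv_0_lt_compat; lra].
    + apply Rmult_le_reg_r with X; [lra|].
      replace (2 * ll X / X * X) with (2 * ll X) by (field; lra); lra.
  - repeat apply filter_and.
    + apply ll_eventually_small; lra.
    + apply ll_eventually_ge.
    + exists (exp (exp 1)); intros; lra.
Qed.

(** The rate for the time [X k = exp (c * k)] is nearly optimal for all [n] between
    [exp (- c) * X k] and [X k]. The bets for the index [k] begin in round [k], which
    is negligible against [X k] but makes the mixture finite in each round. *)
Lemma null_upper sg e :
  sg ^ 2 = 1 -> 0 < e <= 1 ->
  null h v w (fun y => moderate y /\ forall N, exists n, (N <= n)%nat /\
    (1 + e) * (sqrt v * lil_scale (INR n)) < sg * partial_sum y n).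
Proof.
  intros Hsg He.
  set (c := e / 4); set (d := e / 16).
  assert (Hc : 0 < c) by (unfold c; lra).
  assert (Hd : 0 < d <= / 2) by (unfold d; lra).
  set (X := fun k => exp (c * INR k)).
  assert (HX : is_lim_seq X p_infty) by (apply exp_step_lim; auto).
  set (lam := fun k => sg * lil_rate (X k)).
  assert (Elam : forall k, lam k ^ 2 * v = lil_rate (X k) ^ 2 * v).
  { intros k; unfold lam; rewrite Rpow_mult_distr, Hsg; ring. }
  destruct (HX _ (rate_eventually_small (d / 4) ltac:(lra))) as [k0 Hk0].
  set (a := fun k => exp 1 * exp (- (1 + e) * ll (X k))).
  assert (Ell : forall k, ll (X k) = ln (c * INR k))
    by (intros; unfold ll, X; rewrite ln_exp; reflexivity).
  assert (Ha : forall k, 0 <= a k)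
    by (intros; left; apply Rmult_lt_0_compat; apply exp_pos).
  assert (HB : exists B, forall n, partial_sum a n <= B).
  { destruct (power_series_bound e ltac:(lra)) as [B HB].
    exists (a 0%nat + exp 1 * exp (- (1 + e) * ln c) * B); intros n.
    assert (E : forall k, (1 <= k)%nat -> a k =
      exp 1 * exp (- (1 + e) * ln c) * exp (- (1 + e) * ln (INR k))).
    { intros k Hk; apply (le_INR 1) in Hk; simpl in Hk.
      unfold a; rewrite Ell, ln_mult by lra.
      replace (- (1 + e) * (ln c + ln (INR k)))
        with (- (1 + e) * ln c + - (1 + e) * ln (INR k)) by ring.
      rewrite exp_plus; ring. }
    apply Rle_trans with (partial_sum a (1 + n)); [apply partial_sum_incr; auto; lia|].
    rewrite partial_sum_shift; simpl (partial_sum a 1); rewrite Rplus_0_l.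
    apply Rplus_le_compat_l.
    rewrite (partial_sum_ext _ (fun k => exp 1 * exp (- (1 + e) * ln c) *
      exp (- (1 + e) * ln (INR (1 + k))))) by (intros; apply E; lia).
    rewrite partial_sum_scal; apply Rmult_le_compat_l.
    - left; apply Rmult_lt_0_compat; apply exp_pos.
    - apply Rle_trans with (2 := HB (1 + n)%nat).
      rewrite (partial_sum_shift _ 1).
      assert (0 <= partial_sum (fun k => exp (- (1 + e) * ln (INR k))) 1)
        by (apply partial_sum_ge0; intros; left; apply exp_pos).
      lra. }
  destruct HB as [B HB].
  apply null_incl with (fun y => forall p, exists k n, (p <= k)%nat /\
    1 <= a k * overcap v k d (lam k) (past y n)).
  2:{ apply (null_limsup h v w (fun k => overcap v k d (lam k)) a B k0); auto.
      intros k Hk; specialize (Hk0 k Hk); apply overcap_capital_process; [lra|].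
      rewrite Elam; lra. }
  intros y [Hmod Hy] p.
  destruct (HX _ (moderate_rate y (d / 4) Hmod ltac:(lra))) as [k1 Hk1].
  destruct (HX _ (ll_eventually_ge (8 / e))) as [k2 Hk2].
  destruct (eventually_INR _ (moderate_uniform y 1 Hmod ltac:(lra))) as [k3 Hk3].
  destruct (exp_beats_power c v Hc v_pos) as [k4 Hk4].
  destruct (INR_unbounded (exp (exp 1))) as [k5 Hk5].
  destruct (exp_beats_power c (2 * c * exp (- c)) Hc) as [k6 Hk6].
  { apply Rmult_lt_0_compat; [lra|apply exp_pos]. }
  assert (Hlate : exists K, (k0 <= K /\ k1 <= K /\ k2 <= K /\ k3 <= K /\ k4 <= K
    /\ k5 <= K /\ k6 <= K /\ p <= K /\ 2 <= K)%nat).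
  { exists (k0 + k1 + k2 + k3 + k4 + k5 + k6 + p + 2)%nat; lia. }
  destruct Hlate as [K HK].
  destruct (INR_unbounded (Rmax (X K) 1)) as [N0 HN0].
  assert (HN1 : X K < INR N0) by (apply Rle_lt_trans with (2 := HN0), Rmax_l).
  assert (HN2 : 1 < INR N0) by (apply Rle_lt_trans with (2 := HN0), Rmax_r).
  destruct (Hy N0) as (n & Hn & Hbig).
  apply le_INR in Hn.
  destruct (grid_point c (INR n) Hc ltac:(lra)) as (k & Hup & Hlow).
  fold (X k) in Hup, Hlow.
  assert (HKk : (K <= k)%nat).
  { apply Nat.nlt_ge; intros H.
    assert (X k <= X K); [|lra].
    apply exp_le_mono, Rmult_le_compat_l; [lra|apply le_INR; lia]. }
  exists k, n; split; [lia|].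
  set (L := ll (X k)).
  assert (HL : 8 / e <= L) by (apply Hk2; lia).
  assert (H8 : 8 <= 8 / e).
  { apply Rmult_le_reg_r with e; [lra|].
    unfold Rdiv; rewrite Rmult_assoc, Rinv_l by lra; lra. }
  assert (HX0 : 0 < X k) by apply exp_pos.
  assert (Hk5' : exp (exp 1) <= INR k)
    by (apply Rlt_le, Rlt_le_trans with (1 := Hk5), le_INR; lia).
  assert (Hk2' : 2 <= INR k) by (apply (le_INR 2); lia).
  assert (Hkn : (k <= n)%nat).
  { apply INR_le, Rmult_le_reg_r with (exp c); [apply exp_pos|].
    apply Rle_trans with (2 := Hup).
    assert (H := Hk6 k ltac:(lia)).
    apply Rle_trans with (INR k ^ 5 * exp c).
    - apply Rmult_le_compat_r; [left; apply exp_pos|].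
      rewrite <- (pow_1 (INR k)) at 1; apply Rle_pow; [lra|lia].
    - apply Rmult_le_reg_l with (2 * c * exp (- c)).
      + apply Rmult_lt_0_compat; [lra|apply exp_pos].
      + replace (2 * c * exp (- c) * (INR k ^ 5 * exp c))
          with (2 * (c * INR k) * INR k ^ 4 * (exp (- c) * exp c)) by ring.
        rewrite <- exp_plus, Rplus_opp_l, exp_0, Rmult_1_r; exact H. }
  assert (Hjump : forall i, (k <= i < n)%nat -> Rabs (lam k * y i) <= d / 4).
  { intros i Hi; unfold lam; rewrite !Rabs_mult, (Rabs_right (lil_rate _))
      by (apply Rle_ge, sqrt_pos).
    replace (Rabs sg) with 1.
    - rewrite Rmult_1_l; apply Hk1; [lia|].
      apply Rle_trans with (2 := Hlow), le_INR; lia.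
    - rewrite <- pow2_abs in Hsg; assert (H := Rabs_pos sg); nra. }
  (* The increments before round [k], which the strategy misses, are negligible. *)
  assert (Hmiss : Rabs (lam k * partial_sum y k) <= 1).
  { assert (HS : Rabs (partial_sum y k) <= INR k ^ 2).
    { replace (INR k ^ 2) with (INR k * INR k) by ring.
      apply partial_sum_abs_le; intros i Hi.
      apply Rle_trans with (1 := Hk3 k ltac:(lia) i ltac:(apply le_INR; lia)).
      rewrite Rmult_1_l; apply jump_scale_le_self; auto. }
    rewrite Rabs_mult; apply Rle_trans with (Rabs (lam k) * INR k ^ 2);
      [apply Rmult_le_compat_l; auto using Rabs_pos|].
    apply Rsqr_incr_0_var; [|lra]; rewrite !Rsqr_pow2, pow1, Rpow_mult_distr, pow2_abs.
    apply Rmult_le_reg_r with v; auto.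
    replace (lam k ^ 2 * (INR k ^ 2) ^ 2 * v) with (lam k ^ 2 * v * INR k ^ 4) by ring.
    rewrite Elam, lil_rate_sqr by (try fold L; lra); fold L.
    apply Rmult_le_reg_r with (X k); auto.
    replace (2 * L / X k * INR k ^ 4 * X k) with (2 * L * INR k ^ 4) by (field; lra).
    rewrite Rmult_1_l; apply Rle_trans with (2 := Hk4 k ltac:(lia)).
    apply Rmult_le_compat_r; [apply pow_le; lra|].
    apply Rmult_le_compat_l; [lra|].
    unfold L; rewrite Ell.
    assert (H := ln_le_sub_1 (c * INR k) ltac:(nra)); lra. }
  assert (Hl : (1 - e / 8) * L <= ll (INR n)).
  { apply Rle_trans with (L - 1).
    - enough (1 <= e / 8 * L) by lra.
      replace 1 with (e / 8 * (8 / e)) by (field; lra); apply Rmult_le_compat_l; lra.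
    - assert (H1 : c * INR k / 2 <= ln (INR n)).
      { rewrite <- (ln_exp (c * INR k / 2)); apply ln_le; [apply exp_pos|].
        apply Rle_trans with (X k * exp (- c)).
        - unfold X; rewrite <- exp_plus; apply exp_le_mono; nra.
        - apply Rmult_le_reg_r with (exp c); [apply exp_pos|].
          rewrite Rmult_assoc, <- exp_plus, Rplus_opp_l, exp_0; lra. }
      apply Rle_trans with (ln (c * INR k / 2)); [|apply ln_le; auto; nra].
      rewrite ln_div by nra; unfold L; rewrite Ell.
      assert (H2 := ln_le_sub_1 2 ltac:(lra)); lra. }
  set (s := sqrt (INR n / X k)).
  assert (Hs2 : s ^ 2 = INR n / X k).
  { apply pow2_sqrt; apply Rmult_le_pos; [lra|left; apply Rinv_0_lt_compat; auto]. }
  assert (Hs : 1 - e / 8 <= s <= 1).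
  { split.
    - apply Rle_trans with (exp (- (e / 8))); [assert (H := exp_ineq1_le (- (e / 8))); lra|].
      unfold s; rewrite <- (sqrt_pow2 (exp _)) by (left; apply exp_pos).
      apply sqrt_le_1_alt; simpl; rewrite Rmult_1_r, <- exp_plus.
      apply Rmult_le_reg_r with (X k * exp c); [apply Rmult_lt_0_compat; auto; apply exp_pos|].
      replace (INR n / X k * (X k * exp c)) with (INR n * exp c) by (field; lra).
      apply Rle_trans with (2 := Hup); right.
      replace (exp (- (e / 8) + - (e / 8)) * (X k * exp c))
        with (X k * (exp (- (e / 8) + - (e / 8)) * exp c)) by ring.
      rewrite <- exp_plus; unfold c.
      replace (- (e / 8) + - (e / 8) + e / 4) with 0 by field; rewrite exp_0; ring.
    - rewrite <- sqrt_1; apply sqrt_le_1_alt.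
      apply Rmult_le_reg_r with (X k); auto.
      unfold Rdiv; rewrite Rmult_assoc, Rinv_l; lra. }
  assert (Hgain : 2 * (1 + e) * (1 - e / 8) * s * L <= lam k * partial_sum y n).
  { apply Rle_trans with (lil_rate (X k) * ((1 + e) * (sqrt v * lil_scale (INR n)))).
    - replace (lil_rate (X k) * ((1 + e) * (sqrt v * lil_scale (INR n))))
        with ((1 + e) * (lil_rate (X k) * (sqrt v * lil_scale (INR n)))) by ring.
      rewrite lil_rate_lil_scale by (try fold L; nra); fold s L.
      assert (H : (1 - e / 8) * L <= sqrt (L * ll (INR n))).
      { rewrite <- (sqrt_pow2 ((1 - e / 8) * L)) by nra.
        apply sqrt_le_1_alt; simpl; rewrite Rmult_1_r.
        apply Rmult_le_compat; nra. }
      replace (2 * (1 + e) * (1 - e / 8) * s * L)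
        with ((1 + e) * (2 * (s * ((1 - e / 8) * L)))) by ring.
      apply Rmult_le_compat_l; [lra|]; apply Rmult_le_compat_l; [lra|].
      apply Rmult_le_compat_l; lra.
    - unfold lam; rewrite (Rmult_comm sg), Rmult_assoc.
      apply Rmult_le_compat_l; [apply sqrt_pos|lra]. }
  assert (Hover := overcap_ge_exp v k d (lam k) y n Hd
    ltac:(rewrite Elam; apply Hk0; lia) Hkn Hjump).
  apply Rle_trans with (2 := Rmult_le_compat_l _ _ _ (Ha k) Hover).
  unfold a; rewrite <- !exp_plus; fold L.
  rewrite <- exp_0 at 1; apply exp_le_mono.
  rewrite Elam, lil_rate_sqr by (try fold L; lra); fold L.
  assert (Hq : (1 + 2 * d) * (2 * L / X k) / 2 * (INR n - INR k)
    <= (1 + 2 * d) * s ^ 2 * L).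
  { rewrite Hs2.
    replace ((1 + 2 * d) * (INR n / X k) * L)
      with ((1 + 2 * d) * (2 * L / X k) / 2 * INR n) by (field; lra).
    apply Rmult_le_compat_l; [|lra].
    apply Rmult_le_pos; [|lra]; apply Rmult_le_pos; [lra|].
    apply Rmult_le_pos; [lra|left; apply Rinv_0_lt_compat; auto]. }
  assert (Hexp := upper_exponent e s He Hs); fold d in Hexp.
  apply Rmult_le_compat_r with (r := L) in Hexp; [|lra].
  apply Rabs_le_between in Hmiss.
  lra.
Qed.

End Upper.

(** * The lower half: the position held during a block *)

Lemma harmonic_diverges C : exists n, C <= partial_sum (fun k => / INR (S k)) n.
Proof.
  assert (H : forall n, ln (INR (S n)) <= partial_sum (fun k => / INR (S k)) n).
  { induction n as [|n IH]; [simpl; rewrite ln_1; lra|].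
    cbn [partial_sum].
    assert (Hn : 0 < INR (S n)) by (apply lt_0_INR; lia).
    rewrite (S_INR (S n)).
    assert (E : INR (S n) + 1 = INR (S n) * (1 + / INR (S n))) by (field; lra).
    assert (Hi := Rinv_0_lt_compat _ Hn).
    rewrite E, ln_mult by lra.
    assert (H := ln_le_sub_1 (1 + / INR (S n)) ltac:(lra)); lra. }
  destruct (INR_unbounded (exp C)) as [n Hn].
  exists n; apply Rle_trans with (2 := H n).
  rewrite <- (ln_exp C); apply ln_le; [apply exp_pos|].
  rewrite S_INR; lra.
Qed.

Section Block.

Variables (h : R -> R) (v w : R).

(** An exponential process whose increments are bounded above, at the cost of the
    protection [kap] per unit of capital. *)
Fixpoint undercap (N : nat) (d lam kap : R) (l : list R) : R :=
  match l with
  | [] => 1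
  | y :: l' => undercap N d lam kap l' *
      (if le_lt_dec N (length l')
       then underhedge d (lam ^ 2 * v) (kap * w) (lam * y) (kap * h y) else 1)
  end.

Lemma undercap_idle N d lam kap l : (length l <= N)%nat -> undercap N d lam kap l = 1.
Proof.
  induction l as [|y l IH]; simpl; intros H; auto.
  rewrite IH by lia; destruct le_lt_dec; [lia|ring].
Qed.

Variables (N n1 : nat) (d lam lam' kap Lam : R).
Hypotheses (w_ge0 : 0 <= w) (h_nonneg : forall y, 0 <= h y)
  (Hd : 0 < d <= / 2) (Hq : 0 <= lam ^ 2 * v <= / 4)
  (Hq' : 0 <= lam' ^ 2 * v <= / 4) (Hkap : 0 <= kap) (Hp : kap * w <= / 8)
  (Hlarge : forall y, d / 4 < Rabs (lam * y) -> (lam * y) ^ 2 <= kap * h y)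
  (Hsmall : forall y, Rabs (lam * y) <= d / 4 -> kap * h y <= / 2)
  (HLam : 0 < Lam).

Definition spread (l : list R) : R :=
  1 - / (4 * Lam) * (undercap N d lam kap l - (overcap v N d lam' l + 1) / 2).

Definition jumped (l : list R) : Prop :=
  match l with
  | [] => False
  | y :: l' => (N <= length l')%nat /\ d / 4 < Rabs (lam * y)
  end.

Definition closing (l : list R) : Prop :=
  Lam <= undercap N d lam kap l \/ jumped l \/ (n1 <= length l)%nat.

(** Skeptic sells the process [undercap] and buys half of [overcap], in amounts
    that keep his capital at one half or more. He closes the position when the
    former reaches [Lam], after a large increment, and at the end of the block. *)
Definition block_capital : list R -> R := stopped closing spread.

Lemma block_price_nonneg : 0 <= kap * w.
Proof. apply Rmult_le_pos; auto. Qed.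

Lemma block_ticket_nonneg y : 0 <= kap * h y.
Proof. apply Rmult_le_pos; auto. Qed.

Lemma undercap_open l :
  ~ frozen closing l -> 0 <= undercap N d lam kap l < Lam.
Proof.
  intros H.
  assert (Hlt : undercap N d lam kap l < Lam).
  { apply Rnot_le_lt; intros H'; apply H, frozen_here; left; exact H'. }
  split; auto; clear Hlt; induction l as [|y l IH]; simpl; [lra|].
  apply Rmult_le_pos; [apply IH; intros H'; apply H; left; exact H'|].
  destruct le_lt_dec as [Hl|Hl]; [|lra].
  assert (Hu : Rabs (lam * y) <= d / 4).
  { apply Rnot_lt_le; intros H'; apply H, frozen_here; right; left; split; auto. }
  apply underhedge_ge0; auto; apply block_price_nonneg.
Qed.

(** While the position is open, [undercap] is below [Lam]; the round that closes it
    at most doubles [undercap], thanks to the protection. *)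
Lemma block_capital_ge_half l : / 2 <= block_capital l.
Proof.
  unfold block_capital; induction l as [|y l IH].
  - simpl; unfold spread; simpl.
    replace (1 - (1 + 1) / 2) with 0 by field; lra.
  - destruct (classic (frozen closing l)) as [Hf|Hf].
    + rewrite stopped_cons_frozen; auto.
    + rewrite stopped_cons_unfrozen by auto; unfold spread.
      assert (HG := undercap_open l Hf).
      assert (HF := overcap_ge0 v N d lam' (y :: l) ltac:(lra) Hq').
      assert (HG2 : undercap N d lam kap (y :: l) <= 2 * Lam).
      { cbn [undercap]; destruct le_lt_dec as [Hl|Hl]; [|lra].
        assert (H := underhedge_le2 d (lam ^ 2 * v) (kap * w) (lam * y) (kap * h y) Hd
          (proj1 Hq) Hp (block_ticket_nonneg y) (Hlarge y)).
        apply Rle_trans with (undercap N d lam kap l * 2).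
        - apply Rmult_le_compat_l; lra.
        - lra. }
      assert (H4 : 0 < / (4 * Lam)) by (apply Rinv_0_lt_compat; lra).
      assert (H5 : / (4 * Lam) * (undercap N d lam kap (y :: l) - (overcap v N d lam' (y :: l) + 1) / 2)
        <= / (4 * Lam) * (2 * Lam)) by (apply Rmult_le_compat_l; lra).
      replace (/ (4 * Lam) * (2 * Lam)) with (/ 2) in H5 by (field; lra); lra.
Qed.

Lemma block_capital_process : capital_process h v w N block_capital.
Proof.
  split; [|split].
  - apply stopped_supermartingale; intros l _.
    set (G := undercap N d lam kap l); set (F := overcap v N d lam' l).
    set (th := / (4 * Lam)).
    destruct (le_lt_dec N (length l)) as [H|H].
    + exists (Stake (th * (F / 2 * lam' - G * lam))
        (th * (F / 2 * ((1 + d) / 2 * lam' ^ 2) - G * ((1 - d) / 2 * lam ^ 2)))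
        (th * (G * kap))).
      intros y; unfold spread; simpl; fold F G th.
      destruct le_lt_dec; [|lia].
      unfold gain, overhedge, underhedge; simpl; rewrite Rminus_0_r; lra.
    + apply hedgeable_le with (2 := hedgeable_0 h v w); intros y.
      unfold spread; simpl; fold F G th; destruct le_lt_dec; [lia|lra].
  - intros l; assert (H := block_capital_ge_half l); lra.
  - apply stopped_idle; intros l Hl; unfold spread.
    rewrite undercap_idle, overcap_idle by auto; field; lra.
Qed.

Lemma block_capital_closed l y :
  (n1 <= length l)%nat -> block_capital (y :: l) = block_capital l.
Proof.
  intros H; unfold block_capital; apply stopped_cons_frozen, frozen_here; right; right; auto.
Qed.

Lemma block_capital_success y n :
  (forall i, (N <= i < n1)%nat -> Rabs (lam * y i) <= d / 4) ->
  (forall i, (i < n1)%nat -> undercap N d lam kap (past y i) < Lam) ->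
  undercap N d lam kap (past y n1) <= overcap v N d lam' (past y n1) / 2 ->
  (n1 <= n)%nat -> 1 + / (8 * Lam) <= block_capital (past y n).
Proof.
  intros Hj Hno Hend Hn; induction Hn as [|n Hn IH].
  - assert (Hopen : forall i, (i < n1)%nat -> ~ frozen closing (past y i)).
    { induction i as [|i IH]; intros Hi.
      - simpl; unfold closing; simpl; specialize (Hno 0%nat Hi); simpl in Hno.
        intros [H|[H|H]]; [lra|tauto|lia].
      - cbn [past frozen]; intros [H|H]; [apply IH; auto; lia|].
        specialize (Hno (S i) Hi).
        destruct H as [H|[[H H']|H]].
        + cbn [past] in Hno; lra.
        + rewrite length_past in H; specialize (Hj i ltac:(lia)); lra.
        + cbn [length] in H; rewrite length_past in H; lia. }
    assert (E : block_capital (past y n1) = spread (past y n1)).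
    { unfold block_capital; destruct n1 as [|i]; [reflexivity|].
      cbn [past]; apply stopped_cons_unfrozen, Hopen; lia. }
    rewrite E; unfold spread.
    assert (H4 : 0 < / (4 * Lam)) by (apply Rinv_0_lt_compat; lra).
    replace (/ (8 * Lam)) with (/ (4 * Lam) * / 2) by (field; lra).
    assert (/ (4 * Lam) * / 2 <= / (4 * Lam) *
      ((overcap v N d lam' (past y n1) + 1) / 2 - undercap N d lam kap (past y n1)))
      by (apply Rmult_le_compat_l; lra).
    lra.
  - cbn [past]; rewrite block_capital_closed; auto; rewrite length_past; auto.
Qed.

Lemma undercap_le_exp y n :
  (N <= n)%nat -> (forall i, (N <= i < n)%nat -> Rabs (lam * y i) <= d / 4) ->
  0 <= undercap N d lam kap (past y n) <=
    exp (lam * (partial_sum y n - partial_sum y N)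
         - ((1 - 2 * d) * (lam ^ 2 * v) / 2 - 2 * (kap * w)) * (INR n - INR N)).
Proof.
  intros Hn; induction Hn as [|n Hn IH]; intros Hy.
  - rewrite !Rminus_diag, !Rmult_0_r, Rminus_0_r, exp_0.
    rewrite undercap_idle by (rewrite length_past; auto); lra.
  - cbn [past undercap]; rewrite length_past.
    destruct le_lt_dec; [|lia].
    assert (IH' := IH (fun i Hi => Hy i ltac:(lia))).
    assert (Hyn := Hy n ltac:(lia)).
    assert (H0 := underhedge_ge0 d (lam ^ 2 * v) (kap * w) (lam * y n) (kap * h (y n))
      Hd Hq block_price_nonneg (Hsmall _ Hyn) Hyn).
    replace (lam * (partial_sum y (S n) - partial_sum y N)
         - ((1 - 2 * d) * (lam ^ 2 * v) / 2 - 2 * (kap * w)) * (INR (S n) - INR N))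
      with ((lam * (partial_sum y n - partial_sum y N)
         - ((1 - 2 * d) * (lam ^ 2 * v) / 2 - 2 * (kap * w)) * (INR n - INR N))
       + (lam * y n - (1 - 2 * d) * (lam ^ 2 * v) / 2 + 2 * (kap * w)))
      by (rewrite S_INR; simpl; field).
    rewrite exp_plus; split; [apply Rmult_le_pos; lra|].
    apply Rmult_le_compat; try lra.
    apply underhedge_le_exp; auto using block_price_nonneg, block_ticket_nonneg; lra.
Qed.

End Block.

(** The inequality [2 * s <= 1 + s ^ 2] makes the line on which the exponential
    process equals [Lam] tangent to the parabola [sqrt n]. *)
Lemma hit_exponent g r s :
  0 < g <= / 8 -> 0 <= r <= g ^ 2 / 4 -> 0 <= s ->
  (1 - g) * (2 * (1 - 8 * g) * s + 2 * g)
    - (1 - 2 * (g ^ 2 / 4)) * (1 - g) ^ 2 * (s ^ 2 - r)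
  <= (1 - g) ^ 2 - 2 * g * (1 - g).
Proof.
  intros Hg Hr Hs.
  set (c := (1 - 2 * (g ^ 2 / 4)) * (1 - g)).
  assert (Hc : 1 - 2 * g <= c <= 1) by (unfold c; split; nra).
  enough (2 * (1 - 8 * g) * s + 2 * g - c * (s ^ 2 - r) <= 1 - g - 2 * g).
  { apply Rmult_le_compat_l with (r := 1 - g) in H; [|lra].
    unfold c in H; lra. }
  assert (H1 : 2 * (1 - 8 * g) * s <= (1 - 8 * g) * (1 + s ^ 2)).
  { assert (0 <= (1 - 8 * g) * (1 - s) ^ 2)
      by (apply Rmult_le_pos; [lra|apply pow2_ge_0]).
    lra. }
  assert (Hs2 : 0 <= s ^ 2) by apply pow2_ge_0.
  assert (H2 : (1 - 2 * g) * s ^ 2 <= c * s ^ 2) by (apply Rmult_le_compat_r; lra).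
  assert (H3 : c * r <= g / 4) by nra.
  nra.
Qed.

(** At the end of the block a sum below [1 - 8 * g] times the scale makes the process
    of rate [1 - g] times the rate of the other one exceed it. *)
Lemma end_exponent g r :
  0 < g <= / 8 -> 0 <= r <= g ^ 2 / 4 ->
  g * ((1 - g) * (2 - 14 * g))
    - ((1 - 2 * (g ^ 2 / 4)) - (1 + 2 * (g ^ 2 / 4)) * (1 - g) ^ 2)
      * ((1 - g) ^ 2 * (1 - r))
  <= - (g ^ 2 * (1 - g)).
Proof.
  intros Hg Hr.
  set (b := (1 - 2 * (g ^ 2 / 4)) - (1 + 2 * (g ^ 2 / 4)) * (1 - g) ^ 2).
  assert (Hb : 2 * g * (1 - g) <= b) by (unfold b; nra).
  enough (g * (2 - 14 * g) - b * ((1 - g) * (1 - r)) <= - g ^ 2).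
  { apply Rmult_le_compat_l with (r := 1 - g) in H; [|lra]; lra. }
  assert (H1 : 1 - 2 * g <= (1 - g) * (1 - r)) by nra.
  assert (H2 : 2 * g * (1 - g) * (1 - 2 * g) <= b * ((1 - g) * (1 - r)))
    by (apply Rmult_le_compat; nra).
  nra.
Qed.

(** * The lower half: the sequence of blocks *)

Section Lower.

Variables (h : R -> R) (v w : R).
Hypotheses (h_even : even_function h) (h_C2 : C2 h)
  (h_0 : h 0 = 0) (h'_0 : Derive h 0 = 0) (h''_0 : Derive_n h 2 0 = 0)
  (h''_incr : strictly_increasing_nonneg (Derive_n h 2))
  (h''_concave : concave_nonneg (Derive_n h 2))
  (h_summable :
     ex_series (fun k : nat =>
       let n := INR (k + 3) in / h (sqrt (n / ln (ln n)))))
  (w_ge0 : 0 <= w) (v_pos : 0 < v).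

(** The terms of a convergent series of decreasing terms are of order at most
    [1 / n]. *)
Lemma jump_price_rate :
  exists B N, 0 <= B /\ forall n, (N <= n)%nat -> INR n * / h (jump_scale (INR n)) <= B.
Proof.
  destruct (INR_unbounded (exp (exp 1))) as [N1 HN1].
  set (N := Nat.max N1 3).
  assert (HN : exp (exp 1) <= INR N).
  { assert (INR N1 <= INR N) by (apply le_INR; unfold N; lia); lra. }
  destruct (jump_price_bound h h_even h_C2 h_0 h'_0 h''_0 h''_incr h''_concave h_summable
    1 N ltac:(lra) HN ltac:(unfold N; lia)) as [B HB].
  assert (Hpos : forall n, (N <= n)%nat -> 0 < jump_scale (INR n)).
  { intros n Hn; apply jump_scale_pos; apply Rle_trans with (1 := HN), le_INR; auto. }
  assert (Hmono : forall i n, (N <= i)%nat -> (i <= n)%nat ->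
    / h (jump_scale (INR n)) <= / h (jump_scale (INR i))).
  { intros i n Hi Hin; apply Rinv_le_contravar; [apply h_pos; auto|].
    apply h_incr; auto; [left; auto|].
    apply jump_scale_incr; [|apply le_INR; auto].
    apply Rle_trans with (1 := HN), le_INR; auto. }
  set (f := fun k => if le_lt_dec N k then / h (1 * jump_scale (INR k)) else 0) in *.
  exists (B + INR N * / h (jump_scale (INR N))), N; split.
  - assert (H := HB 0%nat); simpl in H.
    assert (0 <= INR N * / h (jump_scale (INR N))).
    { apply Rmult_le_pos; [apply pos_INR|left; apply Rinv_0_lt_compat, h_pos; auto]. }
    lra.
  - intros n Hn.
    assert (Hsum : forall j, (N <= j)%nat -> (j <= n)%nat ->
      (INR j - INR N) * / h (jump_scale (INR n)) <= partial_sum f j).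
    { intros j Hj; induction Hj as [|j Hj IH]; intros Hjn.
      - rewrite Rminus_diag, Rmult_0_l; apply partial_sum_ge0; intros k.
        unfold f; destruct le_lt_dec; [|lra].
        rewrite Rmult_1_l; left; apply Rinv_0_lt_compat, h_pos; auto.
      - specialize (IH ltac:(lia)); rewrite S_INR; cbn [partial_sum].
        assert (Hf : / h (jump_scale (INR n)) <= f j).
        { unfold f; destruct le_lt_dec; [|lia].
          rewrite Rmult_1_l; apply Hmono; auto; lia. }
        lra. }
    specialize (Hsum n Hn (Nat.le_refl n)); specialize (HB n).
    assert (INR N * / h (jump_scale (INR n)) <= INR N * / h (jump_scale (INR N)))
      by (apply Rmult_le_compat_l; [apply pos_INR|apply Hmono; auto]).
    lra.
Qed.

(** Number of tickets that protects a position at rate [lam] from increments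
    beyond [b / lam]. *)
Definition protection (b lam : R) : R := / (2 * h (b / lam)).

Lemma protection_spec b lam y :
  0 < b -> b <= / 2 -> 0 < lam ->
  0 <= protection b lam
  /\ (b < Rabs (lam * y) -> (lam * y) ^ 2 <= protection b lam * h y)
  /\ (Rabs (lam * y) <= b -> protection b lam * h y <= / 2).
Proof.
  intros Hb Hb1 Hlam; unfold protection; set (y0 := b / lam).
  assert (Hy0 : 0 < y0) by (apply Rdiv_lt_0_compat; auto).
  assert (Eb : b = lam * y0) by (unfold y0; field; lra).
  assert (Hh : 0 < h y0) by (apply h_pos; auto).
  assert (Hi : 0 < / (2 * h y0)) by (apply Rinv_0_lt_compat; lra).
  rewrite Rabs_mult, (Rabs_right lam) by lra.
  split; [lra|split]; intros H.
  - assert (Hy : y0 < Rabs y) by (apply Rmult_lt_reg_l with lam; lra).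
    assert (H1 := h_over_square_incr h h_even h_C2 h_0 h'_0 h''_incr y0 y Hy0 ltac:(lra)).
    apply Rle_trans with (/ (2 * h y0) * ((y / y0) ^ 2 * h y0));
      [|apply Rmult_le_compat_l; lra].
    replace (/ (2 * h y0) * ((y / y0) ^ 2 * h y0)) with ((y / y0) ^ 2 / 2)
      by (field; lra).
    replace ((lam * y) ^ 2) with (b ^ 2 * (y / y0) ^ 2) by (rewrite Eb; field; lra).
    assert (Hb2 : b ^ 2 <= / 2) by nra.
    apply Rmult_le_compat_r with (r := (y / y0) ^ 2) in Hb2; [lra|apply pow2_ge_0].
  - assert (Hy : Rabs y <= y0) by (apply Rmult_le_reg_l with lam; lra).
    rewrite <- (h_abs h h_even y).
    apply Rle_trans with (/ (2 * h y0) * h y0); [|right; field; lra].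
    apply Rmult_le_compat_l; [lra|].
    apply h_incr; auto using Rabs_pos.
Qed.

(** Over a block of length at most [X] the protection costs a bounded amount
    relative to the capital. *)
Lemma protection_cost b al :
  0 < b -> 0 < al ->
  exists B N, 0 <= B /\ forall n, (N <= n)%nat ->
    2 * (protection b (al * lil_rate v (INR n)) * w) * INR n <= B.
Proof.
  intros Hb Hal; destruct jump_price_rate as (B & N & HB & HBn).
  destruct (INR_unbounded (exp (exp 1))) as [N1 HN1].
  set (q := sqrt (2 / v)).
  assert (Hq : 0 < q) by (apply sqrt_lt_R0, Rdiv_lt_0_compat; lra).
  set (c := b / (al * q)).
  assert (Hc : 0 < c) by (apply Rdiv_lt_0_compat; auto; apply Rmult_lt_0_compat; auto).
  set (s := Rmin 1 c).
  assert (Hs : 0 < s <= 1) by (unfold s; split; [apply Rmin_glb_lt; lra|apply Rmin_l]).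
  assert (Hs3 : 0 < s ^ 3) by (apply pow_lt; lra).
  exists (/ s ^ 3 * (w * B)), (Nat.max N N1); split.
  { apply Rmult_le_pos; [left; apply Rinv_0_lt_compat; auto|apply Rmult_le_pos; auto]. }
  intros n Hn; set (X := INR n).
  assert (HX : exp (exp 1) <= X).
  { assert (INR N1 <= X) by (apply le_INR; lia); lra. }
  assert (H0 := exp_exp_ge 1); assert (H1 := ll_ge 1 X HX).
  assert (Hj := jump_scale_pos X HX).
  assert (Hr : lil_rate v X = q / jump_scale X).
  { unfold q; rewrite <- (lil_rate_jump_scale v v_pos X) by lra; field; lra. }
  assert (Hh : 0 < h (jump_scale X)) by (apply h_pos; auto).
  assert (Hy0 : b / (al * lil_rate v X) = c * jump_scale X)
    by (rewrite Hr; unfold c; field; lra).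
  assert (Hhs : s ^ 3 * h (jump_scale X) <= h (c * jump_scale X)).
  { apply Rle_trans with (h (s * jump_scale X)); [apply h_contract; auto; lra|].
    apply h_incr; auto; [apply Rmult_le_pos; lra|].
    apply Rmult_le_compat_r; [lra|apply Rmin_r]. }
  unfold protection; rewrite Hy0.
  assert (Hp : 0 < s ^ 3 * h (jump_scale X)) by (apply Rmult_lt_0_compat; auto).
  replace (2 * (/ (2 * h (c * jump_scale X)) * w) * X)
    with (w * X * / h (c * jump_scale X)) by (field; lra).
  apply Rle_trans with (w * X * / (s ^ 3 * h (jump_scale X))).
  - apply Rmult_le_compat_l; [apply Rmult_le_pos; lra|].
    apply Rinv_le_contravar; auto.
  - rewrite Rinv_mult.
    replace (w * X * (/ s ^ 3 * / h (jump_scale X)))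
      with (/ s ^ 3 * (w * (X * / h (jump_scale X)))) by ring.
    apply Rmult_le_compat_l; [left; apply Rinv_0_lt_compat; auto|].
    apply Rmult_le_compat_l; auto; apply HBn; lia.
Qed.

(** If the sums are too small, then in every late block [undercap] does not reach
    [Lam] ([hit_exponent]), and at the end it is at most half of [overcap]
    ([end_exponent]), so that the position is closed with a gain. The lower bound on
    the sums at the beginning of the block comes from the upper half for the
    opposite sums. *)
Lemma null_lower e :
  0 < e <= 1 ->
  null h v w (fun y => moderate y
    /\ (exists N, forall n, (N <= n)%nat ->
          - partial_sum y n <= 2 * (sqrt v * lil_scale (INR n)))
    /\ (exists N, forall n, (N <= n)%nat ->
          partial_sum y n <= (1 - e) * (sqrt v * lil_scale (INR n)))).
Proof.
  intros He.
  (* The rate is slightly below the optimal one, so that the level [Lam] stays of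
     smaller order than [ln X]; the second rate is closer to the first than the
     deficit [e] of the sums, and the relative error [d] of the quadratic
     approximation is too small to close the gap between the exponents. *)
  set (g := e / 8); set (al := 1 - g); set (d := g ^ 2 / 4).
  assert (Hg : 0 < g <= / 8) by (unfold g; lra).
  assert (Hd : 0 < d <= / 2) by (unfold d; nra).
  assert (Hal : 0 < al <= 1) by (unfold al; lra).
  (* With ratio [rho] the scale at the beginning of a block is at most [g / 2] times
     the scale at its end. *)
  destruct (INR_unbounded (4 / g ^ 2)) as [rho Hrho].
  assert (Hg2 : 0 < g ^ 2) by (apply pow_lt; lra).
  assert (H256 : 256 <= 4 / g ^ 2).
  { apply Rmult_le_reg_r with (g ^ 2); auto.
    unfold Rdiv; rewrite Rmult_assoc, Rinv_l by lra; nra. }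
  assert (Hr : 0 <= / INR rho <= g ^ 2 / 4).
  { split; [left; apply Rinv_0_lt_compat; lra|].
    replace (g ^ 2 / 4) with (/ (4 / g ^ 2)) by (field; lra).
    apply Rinv_le_contravar; lra. }
  assert (Hrho2 : (2 <= rho)%nat).
  { apply INR_le; simpl; lra. }
  set (t := fun k => (rho ^ k)%nat).
  assert (Ht1 : forall k, (k <= t k)%nat)
    by (intros k; apply Nat.lt_le_incl, Nat.pow_gt_lin_r; lia).
  assert (Ht2 : forall j k, (j <= k)%nat -> (t j <= t k)%nat)
    by (intros j k H; apply Nat.pow_le_mono_r; lia).
  set (X := fun k => INR (t (S k))).
  assert (HX : is_lim_seq X p_infty).
  { apply is_lim_seq_le_p_loc with (2 := is_lim_seq_INR).
    exists 0%nat; intros k _; apply le_INR; specialize (Ht1 (S k)); lia. }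
  set (lam := fun k => al * lil_rate v (X k)).
  set (kap := fun k => protection (d / 4) (lam k)).
  set (Lam := fun k => exp (al ^ 2 * ll (X k))).
  set (Z := fun k => block_capital h v w (t k) (t (S k)) d (lam k) (al * lam k) (kap k) (Lam k)).
  assert (HLam : forall k, 0 < Lam k) by (intros; apply exp_pos).
  assert (h_nonneg : forall y, 0 <= h y) by (intros; apply h_ge0; auto).
  destruct (protection_cost (d / 4) al ltac:(lra) ltac:(lra)) as (B & N1 & HB & HBn).
  assert (Hcost : exists k0, forall k, (k0 <= k)%nat -> 2 * (kap k * w) * X k <= B).
  { exists N1; intros k Hk; apply HBn; specialize (Ht1 (S k)); lia. }
  destruct Hcost as [k1 Hk1].
  destruct (HX _ (rate_eventually_small v v_pos (d / 4) ltac:(lra))) as [k2 Hk2].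
  assert (Hbig : Rbar_locally p_infty (fun x => exp (exp 1) <= x /\ 4 * B <= x)).
  { exists (Rmax (exp (exp 1)) (4 * B)); intros x Hx; split; left;
      apply Rle_lt_trans with (2 := Hx); [apply Rmax_l|apply Rmax_r]. }
  destruct (HX _ Hbig) as [k3 Hk3].
  set (k0 := Nat.max k1 (Nat.max k2 k3)).
  (* The hypotheses under which a block position is sound hold from [k0] on. *)
  assert (Hblock : forall k, (k0 <= k)%nat ->
    0 < lam k /\ 0 <= lam k ^ 2 * v <= d / 4 /\ 0 <= (al * lam k) ^ 2 * v <= d / 4
    /\ 0 <= kap k /\ kap k * w <= / 8
    /\ (forall y, d / 4 < Rabs (lam k * y) -> (lam k * y) ^ 2 <= kap k * h y)
    /\ (forall y, Rabs (lam k * y) <= d / 4 -> kap k * h y <= / 2)).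
  { intros k Hk.
    destruct (Hk3 k ltac:(unfold k0 in Hk; lia)) as [H1 H2].
    assert (H3 := Hk1 k ltac:(unfold k0 in Hk; lia)).
    assert (H4 := Hk2 k ltac:(unfold k0 in Hk; lia)); simpl in H4.
    assert (H5 := exp_exp_ge 1); assert (H6 := ll_ge 1 _ H1).
    assert (Hlam : 0 < lam k).
    { apply Rmult_lt_0_compat; [lra|]; apply sqrt_lt_R0, Rdiv_lt_0_compat; [lra|].
      apply Rmult_lt_0_compat; lra. }
    assert (Hsq : forall q, 0 <= q <= d / 4 -> 0 <= al ^ 2 * q <= d / 4).
    { intros q Hq'; assert (0 <= al ^ 2 <= 1) by nra; split; [apply Rmult_le_pos|]; nra. }
    assert (Hq : 0 <= lam k ^ 2 * v <= d / 4).
    { unfold lam; rewrite Rpow_mult_distr, Rmult_assoc; apply Hsq; exact H4. }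
    split; [auto|]; split; [auto|]; split.
    { rewrite Rpow_mult_distr, Rmult_assoc; apply Hsq; auto. }
    split; [apply (protection_spec _ _ 0); lra|].
    split; [apply Rmult_le_reg_r with (X k); lra|].
    split; intros y; apply protection_spec; lra. }
  apply null_of_blocks with (Z := Z) (t := t) (k0 := k0) (th := fun k => / (8 * Lam k)).
  - auto.
  - auto.
  - intros k Hk; destruct (Hblock k Hk) as (H1 & H2 & H3 & H4 & H5 & H6 & H7).
    apply block_capital_process; auto; lra.
  - intros k l Hk; destruct (Hblock k Hk) as (H1 & H2 & H3 & H4 & H5 & H6 & H7).
    apply block_capital_ge_half; auto; lra.
  - intros k l y _ H; apply block_capital_closed; auto.
  - intros k; left; apply Rinv_0_lt_compat; specialize (HLam k); lra.
  - assert (Hlr : 1 <= ln (INR rho)).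
    { rewrite <- (ln_exp 1); apply ln_le; [apply exp_pos|].
      assert (H := exp_le_3); lra. }
    intros C; destruct (harmonic_diverges (8 * ln (INR rho) * C)) as [n Hn].
    exists n; apply Rmult_le_reg_l with (8 * ln (INR rho)); [lra|].
    apply Rle_trans with (1 := Hn).
    rewrite <- partial_sum_scal; apply partial_sum_le; intros k _.
    assert (Hk : 1 <= INR (S k)) by (rewrite S_INR; assert (H := pos_INR k); lra).
    assert (ElnX : ln (X k) = INR (S k) * ln (INR rho))
      by (unfold X, t; rewrite pow_INR, ln_pow by lra; reflexivity).
    assert (H1 : 1 <= ln (X k)) by (rewrite ElnX; nra).
    assert (HLle : Lam k <= ln (X k)).
    { unfold Lam; rewrite <- (exp_ln (ln (X k))) by lra.
      apply exp_le_mono; fold (ll (X k)).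
      assert (0 <= ll (X k)) by (unfold ll; rewrite <- ln_1; apply ln_le; lra).
      assert (al ^ 2 <= 1) by nra; nra. }
    apply Rmult_le_reg_r with (INR (S k) * Lam k);
      [apply Rmult_lt_0_compat; [lra|apply HLam]|].
    assert (HLk := HLam k).
    replace (/ INR (S k) * (INR (S k) * Lam k)) with (Lam k) by (field; lra).
    replace (8 * ln (INR rho) * / (8 * Lam k) * (INR (S k) * Lam k))
      with (INR (S k) * ln (INR rho)) by (field; lra).
    lra.
  - intros y (Hmod & [Nm Hm] & [Nu Hu]).
    (* For [ll X >= C0] the gap between the exponents covers the cost [B] of the
       protection and a factor 2. *)
    set (C0 := (B + 1) / (g ^ 2 * (1 - g))).
    assert (Hg3 : 0 < g ^ 2 * (1 - g)) by (apply Rmult_lt_0_compat; lra).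
    destruct (HX _ (moderate_rate v v_pos y (d / 4) Hmod ltac:(lra))) as [k4 Hk4].
    destruct (HX _ (ll_eventually_ge C0)) as [k5 Hk5].
    destruct (INR_unbounded (exp (exp 1))) as [k6 Hk6].
    exists (k0 + k4 + k5 + k6 + Nm + Nu)%nat; intros k n Hk Hn.
    destruct (Hblock k ltac:(lia)) as (Hlam & Hq & Hq' & Hkap & Hp & Hlarge & Hsmall).
    assert (HXk := Hk1 k ltac:(unfold k0 in Hk; lia)).
    assert (Hjump := Hk4 k ltac:(lia)); simpl in Hjump.
    assert (HL := Hk5 k ltac:(lia)); simpl in HL.
    set (r := / INR rho) in *.
    assert (Htk : (k <= t k)%nat) by auto.
    assert (HtS : (t k <= t (S k))%nat) by (apply Ht2; lia).
    assert (HN0 : exp (exp 1) <= INR (t k)).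
    { apply Rlt_le, Rlt_le_trans with (1 := Hk6), le_INR; lia. }
    assert (He0 := exp_exp_ge 1).
    assert (HNle : INR (t k) <= X k) by (apply le_INR, Ht2; lia).
    assert (EN : INR (t k) / X k = r).
    { assert (H : INR (rho ^ k) <> 0) by (change (INR (t k) <> 0); lra).
      unfold X, t, r; rewrite Nat.pow_succ_r', mult_INR; field; split; auto; lra. }
    assert (Elam : lam k ^ 2 * v = al ^ 2 * (2 * ll (X k) / X k)).
    { unfold lam; rewrite Rpow_mult_distr, Rmult_assoc, lil_rate_sqr;
        try reflexivity; try lra.
      assert (H := ll_ge 1 (X k) ltac:(lra)); lra. }
    set (L := ll (X k)) in *.
    assert (HL1 : 1 <= L) by (apply ll_ge; lra).
    assert (HgL : B + 1 <= g ^ 2 * (1 - g) * L).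
    { replace (B + 1) with (g ^ 2 * (1 - g) * C0)
        by (unfold C0; field; split; lra).
      apply Rmult_le_compat_l; lra. }
    assert (Hrate0 : 0 <= lil_rate v (X k)) by apply sqrt_pos.
    assert (Hscale : forall i, (t k <= i)%nat -> (i <= t (S k))%nat ->
      lil_rate v (X k) * (sqrt v * lil_scale (INR i)) <= 2 * sqrt (INR i / X k) * L).
    { intros i Hi Hi'.
      assert (H1 : INR (t k) <= INR i) by (apply le_INR; auto).
      assert (H2 : INR i <= X k) by (apply le_INR; auto).
      assert (H3 := ll_incr (INR i) (X k) ltac:(lra) H2).
      assert (H4 := ll_ge 1 (INR i) ltac:(lra)); fold L in H3.
      rewrite lil_rate_lil_scale by (try fold L; lra); fold L.
      rewrite Rmult_assoc; apply Rmult_le_compat_l; [lra|].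
      apply Rmult_le_compat_l; [apply sqrt_pos|].
      rewrite <- (sqrt_pow2 L) at 2 by lra.
      apply sqrt_le_1_alt; simpl; rewrite Rmult_1_r; apply Rmult_le_compat_l; lra. }
    assert (Hstart : - (lil_rate v (X k) * partial_sum y (t k)) <= 2 * g * L).
    { assert (H1 := Hm (t k) ltac:(lia)).
      apply Rmult_le_compat_l with (r := lil_rate v (X k)) in H1; auto.
      assert (H2 := Hscale (t k) ltac:(lia) HtS); rewrite EN in H2.
      assert (H3 : sqrt r <= g / 2).
      { rewrite <- (sqrt_pow2 (g / 2)) by lra; apply sqrt_le_1_alt; lra. }
      apply Rmult_le_compat_r with (r := L) in H3; [|lra].
      lra. }
    assert (Hmove : forall i, (t k <= i)%nat -> (i <= t (S k))%nat ->
      lam k * (partial_sum y i - partial_sum y (t k))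
        <= (1 - g) * (2 * (1 - 8 * g) * sqrt (INR i / X k) + 2 * g) * L).
    { intros i Hi Hi'.
      assert (H1 := Hu i ltac:(lia)).
      apply Rmult_le_compat_l with (r := lil_rate v (X k)) in H1; auto.
      assert (H2 := Hscale i Hi Hi').
      apply Rmult_le_compat_l with (r := 1 - e) in H2; [|lra].
      replace (1 - 8 * g) with (1 - e) by (unfold g; field).
      unfold lam; rewrite !Rmult_assoc; fold al.
      apply Rmult_le_compat_l; lra. }
    assert (Hfrac : forall i, (t k <= i)%nat -> (i <= t (S k))%nat ->
      0 <= sqrt (INR i / X k) /\ INR i - INR (t k) = (sqrt (INR i / X k) ^ 2 - r) * X k).
    { intros i Hi Hi'; split; [apply sqrt_pos|].
      rewrite pow2_sqrt; [rewrite <- EN; field; lra|].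
      apply Rmult_le_pos; [apply pos_INR|left; apply Rinv_0_lt_compat; lra]. }
    assert (Hsafe : forall i, (t k <= i)%nat -> (i < t (S k))%nat ->
      Rabs (lam k * y i) <= d / 4).
    { intros i Hi Hi'; rewrite Rabs_mult, (Rabs_right (lam k)) by lra.
      apply Rle_trans with (2 := Hjump i ltac:(apply le_INR; lia)).
      apply Rmult_le_compat_r; [apply Rabs_pos|].
      unfold lam; rewrite <- (Rmult_1_l (lil_rate v (X k))) at 2.
      apply Rmult_le_compat_r; lra. }
    assert (Hp0 : 0 <= kap k * w) by (apply Rmult_le_pos; auto).
    (* [undercap] is estimated at every time of the block, [overcap] at its end. *)
    assert (Hunder : forall i, (t k <= i)%nat -> (i <= t (S k))%nat ->
      undercap h v w (t k) d (lam k) (kap k) (past y i) <=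
      exp (lam k * (partial_sum y i - partial_sum y (t k))
        - (1 - 2 * d) * al ^ 2 * (sqrt (INR i / X k) ^ 2 - r) * L + B)).
    { intros i Hi Hi'.
      destruct (undercap_le_exp h v w (t k) d (lam k) (kap k) w_ge0 h_nonneg Hd
        ltac:(lra) Hkap Hsmall y i Hi) as [_ H].
      { intros j Hj; apply Hsafe; lia. }
      apply Rle_trans with (1 := H), exp_le_mono.
      destruct (Hfrac i Hi Hi') as [_ E].
      rewrite Elam.
      assert (H1 : 2 * (kap k * w) * (INR i - INR (t k)) <= B).
      { apply Rle_trans with (2 := HXk); apply Rmult_le_compat_l; [lra|].
        assert (INR i <= X k) by (apply le_INR; auto).
        assert (0 <= INR (t k)) by apply pos_INR; lra. }
      assert (H2 : (1 - 2 * d) * (al ^ 2 * (2 * L / X k)) / 2 * (INR i - INR (t k))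
        = (1 - 2 * d) * al ^ 2 * (sqrt (INR i / X k) ^ 2 - r) * L)
        by (rewrite E; field; lra).
      lra. }
    assert (Hend1 : sqrt (INR (t (S k)) / X k) = 1).
    { unfold X; unfold Rdiv; rewrite Rinv_r, sqrt_1; auto.
      fold (X k); lra. }
    apply block_capital_success; auto; try lra.
    + intros i Hi; apply Hsafe; lia.
    + intros i Hi.
      destruct (Nat.lt_ge_cases i (t k)) as [Hlt|Hge].
      * rewrite undercap_idle by (rewrite length_past; lia).
        unfold Lam; rewrite <- exp_0; apply exp_increasing.
        apply Rmult_lt_0_compat; [apply pow_lt; lra|fold L; lra].
      * apply Rle_lt_trans with (1 := Hunder i Hge ltac:(lia)).
        unfold Lam; apply exp_increasing; fold L.
        destruct (Hfrac i Hge ltac:(lia)) as [Hs _].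
        assert (H1 := Hmove i Hge ltac:(lia)).
        assert (H2 := hit_exponent g r (sqrt (INR i / X k)) Hg Hr Hs).
        apply Rmult_le_compat_r with (r := L) in H2; [|lra].
        assert (H3 : g ^ 2 * (1 - g) * L <= 2 * g * (1 - g) * L).
        { apply Rmult_le_compat_r; [lra|]; apply Rmult_le_compat_r; [lra|nra]. }
        unfold al, d; lra.
    + assert (HG := Hunder (t (S k)) HtS ltac:(lia)).
      assert (HF := overcap_ge_exp v (t k) d (al * lam k) y (t (S k)) Hd Hq'
        HtS).
      apply Rle_trans with (1 := HG).
      apply Rmult_le_reg_r with 2; [lra|].
      replace (overcap v (t k) d (al * lam k) (past y (t (S k))) / 2 * 2)
        with (overcap v (t k) d (al * lam k) (past y (t (S k)))) by field.
      refine (Rle_trans _ _ _ _ (HF _)).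
      2:{ intros i Hi; rewrite Rmult_assoc, Rabs_mult, (Rabs_right al) by lra.
          assert (H := Hsafe i ltac:(lia) ltac:(lia)).
          assert (H' := Rabs_pos (lam k * y i)).
          apply Rle_trans with (1 * Rabs (lam k * y i)); [apply Rmult_le_compat_r|]; lra. }
      assert (H2e : 2 <= exp 1) by (assert (H := exp_ineq1_le 1); lra).
      match goal with |- exp ?a * 2 <= exp ?b => enough (a + 1 <= b) end.
      { apply exp_le_mono in H; rewrite exp_plus in H.
        apply Rle_trans with (2 := H), Rmult_le_compat_l; auto; left; apply exp_pos. }
      destruct (Hfrac (t (S k)) HtS ltac:(lia)) as [_ E].
      assert (H1 := Hmove (t (S k)) HtS ltac:(lia)).
      rewrite Hend1 in *.
      rewrite Rpow_mult_distr, (Rmult_assoc (al ^ 2) (lam k ^ 2) v), Elam, E.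
      set (D := partial_sum y (t (S k)) - partial_sum y (t k)) in *.
      replace ((1 + 2 * d) * (al ^ 2 * (al ^ 2 * (2 * L / X k))) / 2 * ((1 ^ 2 - r) * X k))
        with ((1 + 2 * d) * al ^ 2 * (al ^ 2 * (1 - r)) * L) by (field; lra).
      assert (H2 := end_exponent g r Hg Hr).
      apply Rmult_le_compat_r with (r := L) in H2; [|lra].
      apply Rmult_le_compat_l with (r := g) in H1; [|lra].
      fold al d in H2; fold al in H1.
      replace (al * lam k * D) with (lam k * D - g * (lam k * D)) by (unfold al; ring).
      fold al in HgL; lra.
Qed.

End Lower.

(** * Forcing the law *)

Lemma lil_scale_pos X : exp (exp 1) <= X -> 0 < lil_scale X.
Proof.
  intros H; assert (H0 := exp_exp_ge 1); assert (H1 := ll_ge 1 X H).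
  apply sqrt_lt_R0; nra.
Qed.

Lemma partial_sum_centred x m n :
  partial_sum (fun i => x i - m) n = partial_sum x n - m * INR n.
Proof.
  induction n as [|n IH]; [simpl; ring|].
  cbn [partial_sum]; rewrite IH, S_INR; ring.
Qed.

Lemma small_inv_S eps : 0 < eps -> exists j, / INR (S j) < eps.
Proof.
  intros He; destruct (INR_unbounded (/ eps)) as [j Hj]; exists j.
  rewrite <- (Rinv_inv eps); apply Rinv_lt_contravar.
  - apply Rmult_lt_0_compat; [apply Rinv_0_lt_compat; auto|apply lt_0_INR; lia].
  - rewrite S_INR; lra.
Qed.

Lemma inv_S_bounds j : 0 < / INR (S j) <= 1.
Proof.
  assert (H : 1 <= INR (S j)) by (rewrite S_INR; assert (H := pos_INR j); lra).
  split; [apply Rinv_0_lt_compat; lra|].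
  rewrite <- Rinv_1; apply Rinv_le_contravar; lra.
Qed.

Lemma not_infinitely_often (P Q : nat -> Prop) :
  (forall n, ~ P n -> Q n) -> ~ (forall N, exists n, (N <= n)%nat /\ P n) ->
  exists N, forall n, (N <= n)%nat -> Q n.
Proof.
  intros HPQ H; apply not_all_ex_not in H; destruct H as [N H].
  exists N; intros n Hn; apply HPQ; intros HP; apply H; exists n; auto.
Qed.

(** With variance [0] the squares of the increments can be bought for nothing. *)
Lemma null_squares h w :
  null h 0 w (fun y => forall C, exists n, C <= partial_sum (fun i => y i ^ 2) n).
Proof.
  intros N; exists (tickets (fun y => y ^ 2) 0 N (fun _ => 1)); split.
  - apply tickets_capital_process.
    + exists (Stake 0 1 0); intros y; unfold gain; simpl; rewrite Rminus_0_r; lra.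
    + intros; apply pow2_ge_0.
    + intros; lra.
    + intros; lra.
  - intros y Hy C.
    destruct (Hy (C + partial_sum (fun i => y i ^ 2) N)) as [n Hn].
    exists n; rewrite tickets_past.
    set (b := fun k => if le_lt_dec N k then 1 else 0).
    assert (H : partial_sum (fun i => y i ^ 2) n - partial_sum (fun i => y i ^ 2) N
      <= partial_sum (fun k => b k * y k ^ 2) n).
    { clear; induction n as [|n IH].
      - assert (H := partial_sum_ge0 (fun i => y i ^ 2) N (fun i => pow2_ge_0 (y i))).
        simpl in *; lra.
      - cbn [partial_sum]; unfold b at 2; destruct le_lt_dec as [H|H]; [lra|].
        assert (H1 := partial_sum_incr (fun i => y i ^ 2) (S n) N
          (fun i => pow2_ge_0 (y i)) H); cbn [partial_sum] in H1.
        assert (H2 : 0 <= partial_sum (fun k => b k * y k ^ 2) n).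
        { apply partial_sum_ge0; intros k; apply Rmult_le_pos; [|apply pow2_ge_0].
          unfold b; destruct le_lt_dec; lra. }
        lra. }
    apply Rle_trans with
      (1 + partial_sum (fun k => b k * y k ^ 2) n - 0 * partial_sum b n);
      [lra|right; reflexivity].
Qed.

Lemma partial_sum_cauchy_schwarz y n :
  partial_sum y n ^ 2 <= INR n * partial_sum (fun i => y i ^ 2) n.
Proof.
  induction n as [|n IH]; [simpl; lra|].
  cbn [partial_sum]; rewrite S_INR.
  set (S := partial_sum y n) in *; set (Q := partial_sum (fun i => y i ^ 2) n) in *.
  enough (2 * S * y n <= Q + INR n * y n ^ 2) by nra.
  destruct n as [|n].
  - unfold S, Q; simpl; lra.
  - assert (Hn : 0 < INR (Datatypes.S n)) by (apply lt_0_INR; lia).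
    apply Rmult_le_reg_l with (INR (Datatypes.S n)); auto.
    assert (0 <= (S - INR (Datatypes.S n) * y (Datatypes.S n)) ^ 2) by apply pow2_ge_0.
    nra.
Qed.

Lemma force_LIL_degenerate h m w :
  skeptic_can_force h (constant_forecasts m 0 w) (LIL_event m 0).
Proof.
  apply force_of_null with (1 := null_squares h w).
  intros f x Hb; apply not_all_ex_not in Hb; destruct Hb as [C HC].
  set (y := fun i => x i - m) in *.
  assert (HQ : forall n, partial_sum (fun i => y i ^ 2) n <= C).
  { intros n; apply Rnot_lt_le; intros H; apply HC; exists n; exact (Rlt_le _ _ H). }
  assert (HC0 : 0 <= C) by exact (HQ 0%nat).
  intros eps; rewrite sqrt_0.
  assert (He := cond_pos eps).
  assert (He2 : 0 < 2 * eps ^ 2) by (simpl; nra).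
  destruct (eventually_INR _ (filter_and _ _
    (ll_eventually_ge (C / (2 * eps ^ 2) + 1)) (ll_eventually_ge 1))) as [N1 HN1].
  destruct (INR_unbounded (exp (exp 1))) as [N2 HN2].
  assert (Hu : forall n, (Nat.max N1 N2 <= n)%nat ->
    Rabs ((partial_sum x n - m * INR n) / sqrt (2 * INR n * ln (ln (INR n)))) < eps).
  { intros n Hn; destruct (HN1 n ltac:(lia)) as [H1 _].
    assert (Hn2 : exp (exp 1) <= INR n).
    { assert (INR N2 <= INR n) by (apply le_INR; lia); lra. }
    assert (HA := lil_scale_pos _ Hn2).
    assert (H0 := exp_exp_ge 1); assert (H3 := ll_ge 1 _ Hn2).
    change (sqrt (2 * INR n * ln (ln (INR n)))) with (lil_scale (INR n)).
    rewrite <- partial_sum_centred; fold y.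
    unfold Rdiv; rewrite Rabs_mult, (Rabs_right (/ _))
      by (left; apply Rinv_0_lt_compat; auto).
    apply Rmult_lt_reg_r with (lil_scale (INR n)); auto.
    rewrite Rmult_assoc, Rinv_l, Rmult_1_r by lra.
    apply Rsqr_incrst_0; [|apply Rabs_pos|apply Rmult_le_pos; lra].
    rewrite !Rsqr_pow2, pow2_abs, Rpow_mult_distr.
    apply Rle_lt_trans with (1 := partial_sum_cauchy_schwarz y n).
    unfold lil_scale at 1; rewrite pow2_sqrt by nra.
    apply Rle_lt_trans with (INR n * C); [apply Rmult_le_compat_l; [lra|apply HQ]|].
    replace (eps ^ 2 * (2 * INR n * ll (INR n)))
      with (INR n * (2 * eps ^ 2 * ll (INR n))) by ring.
    apply Rmult_lt_compat_l; [lra|].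
    replace C with (2 * eps ^ 2 * (C / (2 * eps ^ 2))) by (field; lra).
    apply Rmult_lt_compat_l; lra. }
  split.
  - intros N; exists (N + Nat.max N1 N2)%nat; split; [lia|].
    assert (H := Rabs_def2 _ _ (Hu (N + Nat.max N1 N2)%nat ltac:(lia))); lra.
  - exists (Nat.max N1 N2); intros n Hn.
    assert (H := Rabs_def2 _ _ (Hu n Hn)); lra.
Qed.

Section Force.

Variables (h : R -> R) (m v w : R).
Hypotheses (h_even : even_function h) (h_C2 : C2 h)
  (h_0 : h 0 = 0) (h'_0 : Derive h 0 = 0) (h''_0 : Derive_n h 2 0 = 0)
  (h''_incr : strictly_increasing_nonneg (Derive_n h 2))
  (h''_concave : concave_nonneg (Derive_n h 2))
  (h_summable :
     ex_series (fun k : nat =>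
       let n := INR (k + 3) in / h (sqrt (n / ln (ln n)))))
  (w_ge0 : 0 <= w).

Lemma force_LIL_positive :
  0 < v -> skeptic_can_force h (constant_forecasts m v w) (LIL_event m v).
Proof.
  intros Hv.
  set (above := fun sg e y => moderate y /\ forall N, exists n, (N <= n)%nat /\
    (1 + e) * (sqrt v * lil_scale (INR n)) < sg * partial_sum y n).
  set (below := fun e y => moderate y
    /\ (exists N, forall n, (N <= n)%nat ->
          - partial_sum y n <= 2 * (sqrt v * lil_scale (INR n)))
    /\ (exists N, forall n, (N <= n)%nat ->
          partial_sum y n <= (1 - e) * (sqrt v * lil_scale (INR n)))).
  apply force_of_null with (bad := fun y => ~ moderate y \/ above (-1) 1 y
    \/ exists j, above 1 (/ INR (S j)) y \/ below (/ INR (S j)) y).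
  - repeat apply null_or.
    + apply null_not_moderate; auto.
    + apply null_upper; auto; lra.
    + apply (null_union h v w (fun j y =>
        above 1 (/ INR (S j)) y \/ below (/ INR (S j)) y)).
      intros j; assert (Hj := inv_S_bounds j); apply null_or.
      * apply null_upper; auto; lra.
      * apply null_lower; auto.
  - intros f x Hb; set (y := fun i => x i - m) in *.
    assert (Hmod : moderate y) by (apply NNPP; tauto).
    assert (Habove : forall sg e, ~ above sg e y -> exists N, forall n, (N <= n)%nat ->
      sg * partial_sum y n <= (1 + e) * (sqrt v * lil_scale (INR n))).
    { intros sg e H.
      apply not_infinitely_often with (P := fun n =>
        (1 + e) * (sqrt v * lil_scale (INR n)) < sg * partial_sum y n).
      - intros n; apply Rnot_lt_le.
      - intros H'; apply H; split; auto. }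
    destruct (Habove (-1) 1 ltac:(tauto)) as [N1 HN1].
    destruct (INR_unbounded (exp (exp 1))) as [N2 HN2].
    assert (Hs : 0 < sqrt v) by (apply sqrt_lt_R0; auto).
    assert (Hu : forall n, (N2 <= n)%nat -> 0 < lil_scale (INR n)).
    { intros n Hn; apply lil_scale_pos; apply le_INR in Hn; lra. }
    intros eps; assert (He := cond_pos eps).
    destruct (small_inv_S (eps / sqrt v)) as [j Hj]; [apply Rdiv_lt_0_compat; auto|].
    set (e := / INR (S j)) in *.
    assert (Hej : e * sqrt v < eps).
    { replace (pos eps) with (eps / sqrt v * sqrt v) by (field; lra).
      apply Rmult_lt_compat_r; auto. }
    assert (Hnj : ~ (above 1 e y \/ below e y)).
    { intros H; apply Hb; right; right; exists j; exact H. }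
    split.
    + intros N.
      assert (Hlow : exists n, (N + N2 <= n)%nat /\
        (1 - e) * (sqrt v * lil_scale (INR n)) < partial_sum y n).
      { apply NNPP; intros H; apply Hnj; right; split; auto; split.
        - exists N1; intros n Hn; specialize (HN1 n Hn); lra.
        - exists (N + N2)%nat; intros n Hn; apply Rnot_lt_le; intros H'.
          apply H; exists n; auto. }
      destruct Hlow as (n & Hn & Hlow); exists n; split; [lia|].
      assert (HA := Hu n ltac:(lia)).
      change (sqrt (2 * INR n * ln (ln (INR n)))) with (lil_scale (INR n)).
      rewrite <- partial_sum_centred; fold y.
      apply Rmult_lt_reg_r with (lil_scale (INR n)); auto.
      unfold Rdiv; rewrite Rmult_assoc, Rinv_l, Rmult_1_r by lra.
      apply Rle_lt_trans with (2 := Hlow).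
      rewrite <- Rmult_assoc; apply Rmult_le_compat_r; lra.
    + destruct (Habove 1 e ltac:(tauto)) as [N3 HN3].
      exists (N2 + N3)%nat; intros n Hn; specialize (HN3 n ltac:(lia)).
      assert (HA := Hu n ltac:(lia)).
      change (sqrt (2 * INR n * ln (ln (INR n)))) with (lil_scale (INR n)).
      rewrite <- partial_sum_centred; fold y.
      apply Rmult_lt_reg_r with (lil_scale (INR n)); auto.
      unfold Rdiv; rewrite Rmult_assoc, Rinv_l, Rmult_1_r by lra.
      rewrite Rmult_1_l in HN3; apply Rle_lt_trans with (1 := HN3).
      rewrite <- Rmult_assoc; apply Rmult_lt_compat_r; lra.
Qed.

Lemma force_LIL :
  0 <= v -> skeptic_can_force h (constant_forecasts m v w) (LIL_event m v).
Proof.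
  intros [H|<-]; [apply force_LIL_positive; auto|apply force_LIL_degenerate].
Qed.

End Force.

(** * Uniqueness of the parameters *)

(** Changing [m] moves the normalised sums by a multiple of
    [n / sqrt (2 * n * ln (ln n))], which tends to infinity. *)
Lemma LIL_event_mean_le m1 v1 m2 v2 f x :
  LIL_event m1 v1 f x -> LIL_event m2 v2 f x -> m1 <= m2.
Proof.
  intros H1 H2; apply Rnot_lt_le; intros Hm.
  destruct (H1 (mkposreal 1 Rlt_0_1)) as [Hlow _].
  destruct (H2 (mkposreal 1 Rlt_0_1)) as [_ [N1 Hup]]; simpl in *.
  set (C := (sqrt v2 + 2) / (m1 - m2)).
  assert (HC0 : 0 < C) by (apply Rdiv_lt_0_compat; [assert (H := sqrt_pos v2)|]; lra).
  destruct (eventually_INR _ (jump_scale_eventually_ge (C * sqrt 2))) as [N2 HN2].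
  destruct (INR_unbounded (exp (exp 1))) as [N3 HN3].
  destruct (Hlow (N1 + N2 + N3)%nat) as (n & Hn & Hn').
  specialize (Hup n ltac:(lia)); specialize (HN2 n ltac:(lia)); simpl in HN2.
  assert (Hn3 : exp (exp 1) <= INR n).
  { assert (INR N3 <= INR n) by (apply le_INR; lia); lra. }
  assert (HA := lil_scale_pos _ Hn3).
  assert (H0 := exp_exp_ge 1); assert (Hl := ll_ge 1 _ Hn3).
  change (sqrt (2 * INR n * ln (ln (INR n)))) with (lil_scale (INR n)) in *.
  assert (E : INR n / lil_scale (INR n) * sqrt 2 = jump_scale (INR n)).
  { assert (E1 : jump_scale (INR n) * lil_scale (INR n) = INR n * sqrt 2).
    { unfold jump_scale, lil_scale; rewrite <- sqrt_mult_alt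
        by (apply Rmult_le_pos; [lra|left; apply Rinv_0_lt_compat; lra]).
      rewrite <- (sqrt_pow2 (INR n)) at 5 by lra.
      rewrite <- sqrt_mult_alt by (apply pow2_ge_0).
      f_equal; field; lra. }
    apply Rmult_eq_reg_r with (lil_scale (INR n)); [|lra].
    rewrite E1; field; lra. }
  assert (Hs2 : 0 < sqrt 2) by (apply sqrt_lt_R0; lra).
  assert (HC : C <= INR n / lil_scale (INR n)).
  { apply Rmult_le_reg_r with (sqrt 2); lra. }
  assert (Ed : (partial_sum x n - m2 * INR n) / lil_scale (INR n) =
    (partial_sum x n - m1 * INR n) / lil_scale (INR n)
      + (m1 - m2) * (INR n / lil_scale (INR n))) by (field; lra).
  assert (H5 : sqrt v2 + 2 <= (m1 - m2) * (INR n / lil_scale (INR n))).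
  { replace (sqrt v2 + 2) with ((m1 - m2) * C) by (unfold C; field; lra).
    apply Rmult_le_compat_l; lra. }
  assert (H6 := sqrt_pos v1); lra.
Qed.

Lemma LIL_event_unique m1 v1 m2 v2 f x :
  0 <= v1 -> 0 <= v2 -> LIL_event m1 v1 f x -> LIL_event m2 v2 f x ->
  m1 = m2 /\ v1 = v2.
Proof.
  intros Hv1 Hv2 H1 H2.
  assert (Em : m1 = m2) by (apply Rle_antisym; eapply LIL_event_mean_le; eauto).
  split; auto; subst m2.
  unfold LIL_event in H1, H2.
  apply is_LimSup_seq_unique in H1; apply is_LimSup_seq_unique in H2.
  rewrite H1 in H2; injection H2; apply sqrt_inj; auto.
Qed.

(** * Compliance and the equivalences *)

Section Derandomization.

Variable sigma : skeptic_strategy.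

Definition with_stake (acc : list round) (r : round) : list round :=
  acc ++ [Round (rd_fc r) (sigma acc (rd_fc r)) (rd_x r)].

(** The history in which Skeptic's stakes have been replaced by those that
    [sigma] would have chosen. *)
Definition shadow (hist : list round) : list round := fold_left with_stake hist [].

Definition shadow_play (p : play) : play := fun n =>
  Round (rd_fc (p n)) (sigma (shadow (history p n)) (rd_fc (p n))) (rd_x (p n)).

Lemma history_S p n : history p (S n) = history p n ++ [p n].
Proof. unfold history; rewrite seq_S, map_app; reflexivity. Qed.

Lemma history_shadow_play p n : history (shadow_play p) n = shadow (history p n).
Proof.
  induction n as [|n IH]; [reflexivity|].
  rewrite !history_S, IH; unfold shadow; rewrite fold_left_app; reflexivity.
Qed.

Lemma shadow_play_follows p : skeptic_follows sigma (shadow_play p).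
Proof. intros n; rewrite history_shadow_play; reflexivity. Qed.

End Derandomization.

Definition add_stakes (s s' : stake) : stake :=
  Stake (st_M s + st_M s') (st_V s + st_V s') (st_W s + st_W s').

Lemma gain_add h f s s' x :
  gain h f (add_stakes s s') x = gain h f s x + gain h f s' x.
Proof. unfold gain; simpl; ring. Qed.

(** Reality imagines a second Skeptic who forces [E], and by coherence keeps the
    joint capital of both from increasing. *)
Lemma comply_of_force h F E :
  skeptic_can_force h F E -> reality_can_comply h F E.
Proof.
  intros [sigma Hsigma].
  assert (Hx : forall fs : forecast * stake, exists x,
    coherent h (fst fs) -> gain h (fst fs) (snd fs) x <= 0).
  { intros [f s]; simpl; destruct (classic (coherent h f)) as [H|H].
    - destruct (H s) as [x Hx]; exists x; auto.
    - exists 0; tauto. }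
  apply functional_choice in Hx; destruct Hx as [pick Hpick].
  exists (fun hist f s => pick (f, add_stakes s (sigma (shadow sigma hist) f))).
  intros p Hr HF Hduty Hsk.
  set (p' := shadow_play sigma p).
  assert (Hf : forecaster_duty h p') by exact Hduty.
  destruct (Hsigma p' (shadow_play_follows sigma p) HF Hf) as [Hpos HE].
  assert (Hsum : forall n, capital h p n + capital h p' n <= 2).
  { induction n as [|n IH]; simpl; [lra|].
    destruct (Hduty n) as (_ & _ & Hcoh).
    assert (H := Hpick (rd_fc (p n), add_stakes (rd_st (p n))
      (sigma (shadow sigma (history p n)) (rd_fc (p n)))) Hcoh).
    cbn [fst snd] in H; assert (Hn := Hr n); cbn beta in Hn.
    rewrite <- Hn, gain_add in H.
    change (rd_fc (p' n)) with (rd_fc (p n)); change (rd_x (p' n)) with (rd_x (p n)).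
    change (rd_st (p' n)) with (sigma (shadow sigma (history p n)) (rd_fc (p n))).
    lra. }
  split.
  - destruct HE as [HE|Hinf]; [exact HE|].
    apply is_lim_seq_spec in Hinf; destruct (Hinf 2) as [n Hn].
    specialize (Hn n (Nat.le_refl n)); specialize (Hsum n); specialize (Hsk n); lra.
  - exists 2; intros n; specialize (Hsum n); specialize (Hpos n); lra.
Qed.

Lemma duel (sigma : skeptic_strategy) (rho : reality_strategy) (f : forecast) :
  exists p, skeptic_follows sigma p /\ reality_follows rho p
    /\ forall n, forecasts p n = f.
Proof.
  set (move := fun l => Round f (sigma l f) (rho l f (sigma l f))).
  set (hist := fix hist n := match n with
    | O => []
    | S k => hist k ++ [move (hist k)]
    end).
  set (p := fun n => move (hist n)).
  assert (E : forall n, history p n = hist n).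
  { induction n as [|n IH]; [reflexivity|]; rewrite history_S, IH; reflexivity. }
  exists p; repeat split; intros n; rewrite ?E; reflexivity.
Qed.

Lemma force_comply_meet h m v w E1 E2 :
  0 <= v -> 0 <= w -> coherent h (Forecast m v w) ->
  skeptic_can_force h (constant_forecasts m v w) E1 ->
  reality_can_comply h (constant_forecasts m v w) E2 ->
  exists f x, E1 f x /\ E2 f x.
Proof.
  intros Hv Hw Hcoh [sigma Hs] [rho Hr].
  destruct (duel sigma rho (Forecast m v w)) as (p & H1 & H2 & Hf).
  assert (Hduty : forecaster_duty h p).
  { intros n; assert (E := Hf n); unfold forecasts in E; rewrite E; auto. }
  destruct (Hs p H1 Hf Hduty) as [Hpos HE1].
  destruct (Hr p H2 Hf Hduty Hpos) as [HE2 [B HB]].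
  exists (forecasts p), (outcomes p); split; auto.
  destruct HE1 as [HE1|Hinf]; auto.
  apply is_lim_seq_spec in Hinf; destruct (Hinf B) as [n Hn].
  specialize (Hn n (Nat.le_refl n)); specialize (HB n); lra.
Qed.

Theorem corollary1p5 (h : R -> R)
  (h_even : even_function h)
  (h_C2 : C2 h)
  (h_0 : h 0 = 0) (h'_0 : Derive h 0 = 0) (h''_0 : Derive_n h 2 0 = 0)
  (h''_incr : strictly_increasing_nonneg (Derive_n h 2))
  (h''_unbounded : unbounded_nonneg (Derive_n h 2))
  (h''_concave : concave_nonneg (Derive_n h 2))
  (h_summable :
     ex_series (fun k : nat =>
       let n := INR (k + 3) in / h (sqrt (n / ln (ln n)))))
  (m v w : R) (v_ge0 : 0 <= v) (w_ge0 : 0 <= w)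
  (game_coherent : coherent h (Forecast m v w))
  (m' v' : R) (v'_ge0 : 0 <= v') :
  ((m' = m /\ v' = v)
     <-> skeptic_can_force h (constant_forecasts m v w) (LIL_event m' v'))
  /\
  ((m' = m /\ v' = v)
     <-> reality_can_comply h (constant_forecasts m v w) (LIL_event m' v')).
Proof.
  assert (Hforce : skeptic_can_force h (constant_forecasts m v w) (LIL_event m v))
    by (apply force_LIL; auto).
  assert (Hcomply := comply_of_force _ _ _ Hforce).
  split; split.
  - intros [-> ->]; exact Hforce.
  - intros H.
    destruct (force_comply_meet _ _ _ _ _ _ v_ge0 w_ge0 game_coherent H Hcomply)
      as (f & x & H1 & H2).
    exact (LIL_event_unique _ _ _ _ f x v'_ge0 v_ge0 H1 H2).
  - intros [-> ->]; exact Hcomply.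
  - intros H.
    destruct (force_comply_meet _ _ _ _ _ _ v_ge0 w_ge0 game_coherent Hforce H)
      as (f & x & H1 & H2).
    exact (LIL_event_unique _ _ _ _ f x v'_ge0 v_ge0 H2 H1).
Qed.
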